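(* Let $H$ be a fixed strictly balanced graph with at least one edge, having $v$ vertices, $m$ edges, $a$ automorphisms, and density $d=m/v$. Let $X$ be a non-negative random variable with finite expectation and a continuous distribution function $F$ that is differentiable from the right at $0$, with slope $F'(0)=1$. Let the edges of the complete graph $K_n$ be given edge weights that are i.i.d. copies of $X$, and let $W=W_n$ denote the minimum weight of a subgraph of $K_n$ isomorphic to $H$. Then for any non-negative sequence $z=z(n)$, as $n\to\infty$, $$\Pr\left(W\ge \frac{z}{n^{1/d}}\right)=\exp\left\{-\frac{z^{m}}{m!\,a}\right\}+o(1).$$ Also, as $n\to\infty$, $$\mathbb{E}(W)\sim n^{-1/d}\,\frac{(m!\,a)^{1/m}}{m}\,\Gamma\left(\frac1m\right).$$
   Context: The density of a (finite, simple) graph $H$ is $\mathrm{den}(H)=e(H)/v(H)$, where $e(H)$ and $v(H)$ are the numbers of edges and vertices of $H$. $H$ is strictly balanced if $\mathrm{den}(H)>\mathrm{den}(H')$ for all strict (proper, with non-empty vertex set) subgraphs $H'\subset H$. The weight of a subgraph is the sum of the weights of its edges; subgraphs are not necessarily induced. The number of automorphisms $a$ is the cardinality of the automorphism group of $H$. The distribution function is $F(x)=\Pr(X\le x)$, and $F'(0)$ denotes its right derivative at $0$. $\Gamma$ is the Gamma function. $f(n)\sim g(n)$ means $f(n)/g(n)\to1$ as $n\to\infty$. $W$ is defined for $n\ge v$. *)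

(* Defs.v *)
From HB Require Import structures.
From mathcomp Require Import all_boot all_order all_fingroup all_algebra.

Set Implicit Arguments.
Unset Strict Implicit.
Unset Printing Implicit Defensive.

Import Order.TTheory GRing.Theory Num.Theory.

Definition wf_graph (T : finType) (G : {set T} * {set {set T}}) : bool :=
  [forall e in G.2, (#|e| == 2) && (e \subset G.1)].

(* A finite simple graph with vertices drawn from the ambient finite type [T]:
   a vertex set, and a set of edges, each of which is a pair of vertices. *)
Record graph (T : finType) : Type := Graph {
  graph_val : {set T} * {set {set T}};
  graph_wf : wf_graph graph_val
}.

HB.instance Definition _ (T : finType) := [isSub for @graph_val T].
HB.instance Definition _ (T : finType) := [Finite of graph T by <:].

Definition vertices (T : finType) (G : graph T) : {set T} := (graph_val G).1.
Definition edges (T : finType) (G : graph T) : {set {set T}} := (graph_val G).2.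

Definition nverts (T : finType) (G : graph T) : nat := #|vertices G|.
Definition nedges (T : finType) (G : graph T) : nat := #|edges G|.

(* Subgraphs need be neither induced nor spanning. *)
Definition subgraph (T : finType) (G' G : graph T) : bool :=
  (vertices G' \subset vertices G) && (edges G' \subset edges G).

Definition isomorphic (S T : finType) (G : graph S) (H : graph T) : bool :=
  [exists f : {ffun T -> S},
     [&& [forall x in vertices H, forall y in vertices H,
            (f x == f y) ==> (x == y)],
         [set f x | x in vertices H] == vertices G &
         [set [set f x | x in e] | e : {set T} in edges H] == edges G]].

(* An automorphism of [G] is a permutation of [vertices G]; it is represented by
   the unique permutation of [T] extending it by the identity. *)
Definition automorphisms (T : finType) (G : graph T) : {set {perm T}} :=
  [set s : {perm T} | perm_on (vertices G) s &&
     ([set [set s x | x in e] | e : {set T} in edges G] == edges G)].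

Definition nauto (T : finType) (G : graph T) : nat := #|automorphisms G|.

Lemma complete_graph_wf (n : nat) :
  wf_graph ([set: 'I_n], [set e : {set 'I_n} | #|e| == 2]).
Proof. by apply/forallP => e; apply/implyP; rewrite inE subsetT => ->. Qed.

Definition complete_graph (n : nat) : graph 'I_n :=
  Graph (complete_graph_wf n).

Definition copies (T : finType) (H : graph T) (n : nat) : {set graph 'I_n} :=
  [set G : graph 'I_n | subgraph G (complete_graph n) & isomorphic G H].

Definition density (R : numFieldType) (T : finType) (G : graph T) : R :=
  ((nedges G)%:R / (nverts G)%:R)%R.

Definition strictly_balanced (T : finType) (H : graph T) : Prop :=
  forall H' : graph T, subgraph H' H -> H' <> H -> vertices H' <> set0 ->
    (density rat H' < density rat H)%R.

From mathcomp Require Import all_classical all_reals all_analysis.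
Import numFieldNormedType.Exports.

Local Open Scope classical_set_scope.
Local Open Scope ring_scope.

(* Mutual independence of the subfamily of [X] indexed by [D]. *)
Definition independent_in (d : measure_display) (Omega : measurableType d)
    (R : realType) (P : probability Omega R) (I : finType) (D : {set I})
    (X : I -> {RV P >-> R}) : Prop :=
  forall (J : {set I}) (B : I -> set R),
    J \subset D -> (forall i, i \in J -> measurable (B i)) ->
    P (\bigcap_(i in [set` J]) (X i @^-1` B i)) =
      (\prod_(i in J) P (X i @^-1` B i))%E.

(* Only measurable [B] are considered, since the values of a measure outside its
   sigma-algebra are unconstrained. *)
Definition same_distribution (R : realType)
    (d : measure_display) (Omega : measurableType d)
    (P : probability Omega R) (X : {RV P >-> R})
    (d' : measure_display) (Omega' : measurableType d')
    (P' : probability Omega' R) (X' : {RV P' >-> R}) : Prop :=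
  forall B : set R, measurable B -> distribution P X B = distribution P' X' B.

Definition iid_copies_in (R : realType)
    (d0 : measure_display) (Omega0 : measurableType d0)
    (P0 : probability Omega0 R) (X0 : {RV P0 >-> R})
    (d : measure_display) (Omega : measurableType d)
    (P : probability Omega R) (I : finType) (D : {set I})
    (X : I -> {RV P >-> R}) : Prop :=
  independent_in D X /\ forall i, i \in D -> same_distribution (X i) X0.

Definition dist_fun (R : realType) (d : measure_display)
    (Omega : measurableType d) (P : probability Omega R) (X : {RV P >-> R})
    (x : R) : R := fine (cdf X x).

Definition has_right_derivative (R : realType) (f : R -> R) (x l : R) : Prop :=
  (f (x + h) - f x) / h @[h --> 0^'+] --> l.

Definition weight (R : realType) (n : nat) (w : {set 'I_n} -> R)
    (G : graph 'I_n) : R :=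
  \sum_(e in edges G) w e.

(* For [n] at least the number of vertices of [H] this is the infimum of a finite
   non-empty set, hence a minimum; for smaller [n] there are no copies and the
   value is the conventional [inf set0 = 0]. *)
Definition min_weight (R : realType) (T : finType) (H : graph T) (n : nat)
    (w : {set 'I_n} -> R) : R :=
  inf [set weight w G | G in [set` copies H n]].

Definition Gamma (R : realType) (x : R) : R :=
  \int[lebesgue_measure]_(t in `]0, +oo[) (t `^ (x - 1) * expR (- t)).

(* Main.v *)
(** Let [U] be a set of [s] vertices and let [x] be a weight threshold. The
number of copies of [H] in [U] of weight below [x] has mean about
[x ^ m * s ^ v / (m! * a)]. Strict balance makes two distinct copies that share
an edge span a union denser than [H], so such pairs contribute only
[O (s ^ (- 1 / m))] to the error of a sieve which removes the copies one at a
time; hence the probability that [U] contains no light copy is close to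
[exp (- x ^ m * s ^ v / (m! * a))], uniformly in [x].

For the expectation a tail bound is needed. Splitting [U] into two disjoint
halves, on which the weights are independent, gives
[I(U) <= y + Pr(no copy lighter than y in U1) * I(U2)] for the integral [I] of
the tail function. Taking [y] of order [s ^ (- 1 / d)] and iterating shows that
[s ^ (1 / d) * I(U)] is bounded, and one more use of the same inequality makes
the contribution of large weights negligible. *)

From HB Require Import structures.
Require Import Defs.
From mathcomp Require Import all_boot all_order all_fingroup all_algebra.
Import Order.TTheory GRing.Theory Num.Theory.

Set Implicit Arguments.
Unset Strict Implicit.
Unset Printing Implicit Defensive.

(** * Copies of a strictly balanced graph *)

(** At the relevant scale [x] is of order [s ^ (- v / m)]. There are [O (s ^ j)] pairs of copies
    whose union has [j] vertices, and if the union has [e] edges, both copies being light forces [e]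
    weights below [x]; such pairs contribute [O (s ^ (j - v * e / m))]. Strict balance becomes the
    integer inequality [m * j + 1 <= v * e], and this unit is the source of the exponent [1 / m].

    The limit law controls the tail probability only up to an additive error, which cannot be
    integrated over an unbounded range. It is therefore integrated only over [[0, y]] with [y] of
    the order of the mean, at cost [eps * y]; beyond [y] the product over two halves takes its
    place. The finite expectation of [X] enters at the start of the halving induction, for sets of
    bounded size.

    The weights share the law of [X] but may fail to be positive on a null event, which is split off
    wherever positivity of individual weights is used. *)

Lemma edge_card (T : finType) (G : graph T) e : e \in edges G -> #|e| = 2.
Proof.
by case: G => g wf; rewrite /edges /= => eG; have /forallP/(_ e)/implyP/(_ eG)/andP[/eqP] := wf.
Qed.

Lemma edge_sub (T : finType) (G : graph T) e :
  e \in edges G -> e \subset vertices G.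
Proof.
by case: G => g wf; rewrite /edges /vertices /= => eG; have /forallP/(_ e)/implyP/(_ eG)/andP[] := wf.
Qed.

Lemma graph_eqP (T : finType) (G G' : graph T) :
  vertices G = vertices G' -> edges G = edges G' -> G = G'.
Proof.
move=> eV eE; apply: val_inj.
by move: eV eE; rewrite /vertices /edges /=; case: (graph_val G) (graph_val G') => [? ?] [? ?] /= -> ->.
Qed.

Lemma imset_inj_sub (aT rT : finType) (f : aT -> rT) (A B C : {set aT}) :
  {in A &, injective f} -> B \subset A -> C \subset A ->
  f @: B = f @: C -> B = C.
Proof.
move=> fI; wlog suff W : B C / B \subset A -> C \subset A -> f @: B = f @: C -> B \subset C.
  by move=> BA CA E; apply/eqP; rewrite eqEsubset (W B C) // (W C B).
move=> BA CA E; apply/subsetP => x xB.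
have : f x \in f @: C by rewrite -E imset_f.
case/imsetP => y yC fxy; rewrite (fI x y) //; [exact: (subsetP BA)|exact: (subsetP CA)].
Qed.

Lemma copyP (T : finType) (H : graph T) n (G : graph 'I_n) :
  G \in copies H n ->
  exists f : {ffun T -> 'I_n},
    [/\ {in vertices H &, injective f}, f @: vertices H = vertices G &
        [set f @: (e : {set T}) | e in edges H] = edges G].
Proof.
rewrite inE => /andP[_ /existsP[f /and3P[/forallP fI /eqP fV /eqP fE]]].
exists f; split => // x y xV yV fxy.
move: (fI x) => /implyP/(_ xV)/forallP/(_ y)/implyP/(_ yV)/implyP.
by rewrite fxy eqxx => /(_ isT)/eqP.
Qed.

Lemma card_imset_edges (S T : finType) (H : graph T) (f : T -> S) :
  {in vertices H &, injective f} ->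
  {in edges H &, injective (fun e : {set T} => f @: e)}.
Proof. by move=> fI e e' eH e'H; apply: (imset_inj_sub fI); apply: edge_sub. Qed.

Lemma copy_nverts (T : finType) (H : graph T) n (G : graph 'I_n) :
  G \in copies H n -> #|vertices G| = nverts H.
Proof. by case/copyP => f [fI <- _]; rewrite card_in_imset. Qed.

Lemma copy_nedges (T : finType) (H : graph T) n (G : graph 'I_n) :
  G \in copies H n -> #|edges G| = nedges H.
Proof.
by case/copyP => f [fI _ <-]; rewrite card_in_imset //; exact: card_imset_edges.
Qed.

Lemma copy_edges_sub (n : nat) (G : graph 'I_n) :
  edges G \subset edges (complete_graph n).
Proof. by apply/subsetP => e /edge_card; rewrite /edges /= inE => ->. Qed.

Lemma nedges_nverts (T : finType) (H : graph T) :
  (0 < nedges H)%N -> (1 < nverts H)%N.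
Proof.
case/card_gt0P => e eH; rewrite -(edge_card eH).
exact/subset_leq_card/edge_sub.
Qed.

(** Pulling [K] back along an embedding of [H] onto [G] gives a proper subgraph of [H] with as many
    vertices and edges as [K], so strict balance applies to it. Denominators are cleared to stay in
    [nat]. *)
Lemma copy_subgraph_sparser (T : finType) (H : graph T) n (G : graph 'I_n)
    (K : graph 'I_n) :
  strictly_balanced H -> (0 < nverts H)%N -> G \in copies H n ->
  subgraph K G -> K <> G -> vertices K <> set0 ->
  (nverts H * nedges K < nedges H * nverts K)%N.
Proof.
move=> bH v0 Gc /andP[KV KE] KG K0.
have [f [fI fV fE]] := copyP Gc.
pose V' := vertices H :&: f @^-1: vertices K.
pose E' := [set e in edges H | f @: (e : {set T}) \in edges K].
have wf' : wf_graph (V', E').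
  apply/forallP => e; apply/implyP; rewrite inE => /andP[eH feK].
  rewrite (edge_card eH) eqxx subsetI edge_sub //=.
  apply/subsetP => x xe; rewrite inE.
  by apply: (subsetP (edge_sub feK)); rewrite imset_f.
pose H' := Graph wf'.
have V'V : V' \subset vertices H by rewrite subsetIl.
have fV' : f @: V' = vertices K.
  apply/setP => y; apply/imsetP/idP => [[x]|yK].
    by rewrite !inE => /andP[_ ?] ->.
  have : y \in f @: vertices H by rewrite fV (subsetP KV).
  by case/imsetP => x xV yx; exists x => //; rewrite !inE xV -yx.
have fE' : [set f @: (e : {set T}) | e in E'] = edges K.
  apply/setP => y; apply/imsetP/idP => [[x]|yK].
    by rewrite !inE => /andP[_ ?] ->.
  have : y \in [set f @: (e : {set T}) | e in edges H] by rewrite fE (subsetP KE).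
  by case/imsetP => x xV yx; exists x => //; rewrite !inE xV -yx.
have nV : nverts H' = nverts K.
  rewrite /nverts -fV' card_in_imset //.
  by move=> x y /(subsetP V'V) xV /(subsetP V'V) yV; apply: fI.
have nE : nedges H' = nedges K.
  rewrite /nedges -fE' card_in_imset // => x y; rewrite !inE => /andP[xH _] /andP[yH _].
  exact: (card_imset_edges fI).
have sub : subgraph H' H.
  by rewrite /subgraph V'V; apply/subsetP => e; rewrite inE => /andP[].
have ne : H' <> H.
  move=> H'H; apply: KG; apply: graph_eqP.
    by rewrite -fV' -fV -[in RHS]H'H.
  by rewrite -fE' -fE -[in RHS]H'H.
have K'0 : vertices H' <> set0.
  by move=> h; apply: K0; rewrite -fV' (_ : V' = set0) ?imset0.
have := bH H' sub ne K'0.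
rewrite /density nV nE.
have nK : (0 < nverts K)%N by rewrite card_gt0; apply/eqP.
by rewrite ltr_pdivrMr ?ltr0n // mulrAC ltr_pdivlMr ?ltr0n // -!natrM ltr_nat mulnC.
Qed.

(** The intersection [K] of the two copies is a proper non-empty subgraph of [G1], hence strictly
    sparser than [H]. By inclusion-exclusion the union has [2 * v - v(K)] vertices and
    [2 * m - e(K)] edges, so what the intersection lacks in density the union gains. *)
Lemma union_denser (T : finType) (H : graph T) n (G1 G2 : graph 'I_n) :
  strictly_balanced H -> G1 \in copies H n -> G2 \in copies H n ->
  G1 != G2 -> edges G1 :&: edges G2 != set0 ->
  (nedges H * #|vertices G1 :|: vertices G2| <
   nverts H * #|edges G1 :|: edges G2|)%N.
Proof.
move=> bH c1 c2 ne /set0Pn[e eI].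
have wfK : wf_graph (vertices G1 :&: vertices G2, edges G1 :&: edges G2).
  apply/forallP => e'; apply/implyP; rewrite inE => /andP[h1 h2].
  by rewrite (edge_card h1) eqxx subsetI !edge_sub.
pose K := Graph wfK.
have /setIP[e1 e2] := eI.
have [x xe] : exists x, x \in e by apply/card_gt0P; rewrite (edge_card e1).
have xK : x \in vertices K by rewrite inE !(subsetP (edge_sub _) _ xe).
have v0 : (0 < nverts H)%N.
  by rewrite -(copy_nverts c1); apply/card_gt0P; exists x; apply: (subsetP (edge_sub e1)).
have subK : subgraph K G1 by rewrite /subgraph !subsetIl.
(* If [K] were [G1], then [G1] would lie inside [G2]; copies have equal numbers of vertices and
   edges, so the two would coincide. *)
have KG : K <> G1.
  move=> KG; move/negP: ne; apply; apply/eqP; apply: graph_eqP; apply/eqP.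
    rewrite eqEcard (copy_nverts c1) (copy_nverts c2) leqnn andbT.
    by apply/setIidPl; rewrite -[in RHS]KG.
  rewrite eqEcard (copy_nedges c1) (copy_nedges c2) leqnn andbT.
  by apply/setIidPl; rewrite -[in RHS]KG.
have K0 : vertices K <> set0 by move=> h; rewrite h inE in xK.
have := copy_subgraph_sparser bH v0 c1 subK KG K0.
rewrite /nverts /nedges !cardsU (copy_nverts c1) (copy_nverts c2) (copy_nedges c1) (copy_nedges c2).
rewrite -/(nverts K) -/(nedges K).
have : (nverts K <= nverts H)%N by rewrite -(copy_nverts c1) subset_leq_card ?subsetIl.
have : (nedges K <= nedges H)%N by rewrite -(copy_nedges c1) subset_leq_card ?subsetIl.
rewrite /nverts /nedges /= => h1 h2; rewrite mulnBr mulnBr !mulnDr.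
set p := (_ * #|vertices H|)%N; rewrite (mulnC #|vertices H| #|edges H|) -/p (mulnC #|vertices H|) => h3.
apply: ltn_sub2l => //; apply: (leq_trans h3).
by rewrite (leq_trans _ (leq_addr p p)) // leq_mul2l h2 orbT.
Qed.

Definition copies_in (T : finType) (H : graph T) n (U : {set 'I_n}) :=
  [set G in copies H n | vertices G \subset U].

(* Off [vertices H], where the values are irrelevant, they are fixed to [y0], so
   that each embedding of [H] into [U] is represented exactly once. *)
Definition embeddings (T : finType) (H : graph T) n (y0 : 'I_n) (U : {set 'I_n}) :=
  [set f : {ffun T -> 'I_n} |
    [&& [forall x in vertices H, forall y in vertices H, (f x == f y) ==> (x == y)],
        f @: vertices H \subset U &
        [forall x, (x \notin vertices H) ==> (f x == y0)]]].

(** A bare pair rather than a [graph], because well-formedness depends on [f] being injective on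
    each edge. *)
Definition image_graph (T : finType) (H : graph T) n (f : {ffun T -> 'I_n}) :=
  (f @: vertices H, [set f @: (e : {set T}) | e in edges H]).

Lemma embeddingsP (T : finType) (H : graph T) n (y0 : 'I_n) (U : {set 'I_n}) (f : {ffun T -> 'I_n}) :
  reflect [/\ {in vertices H &, injective f}, f @: vertices H \subset U &
              forall x, x \notin vertices H -> f x = y0]
          (f \in embeddings H y0 U).
Proof.
rewrite inE; apply: (iffP and3P) => [[/forallP fI fU /forallP f0]|[fI fU f0]].
  split => // [x y xV yV fxy|x xV].
    move: (fI x) => /implyP/(_ xV)/forallP/(_ y)/implyP/(_ yV)/implyP.
    by rewrite fxy eqxx => /(_ isT)/eqP.
  by apply/eqP/(implyP (f0 x)).
split => //; last by apply/forallP => x; apply/implyP => /f0 ->.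
apply/forallP => x; apply/implyP => xV; apply/forallP => y; apply/implyP => yV.
by apply/implyP => /eqP fxy; apply/eqP/fI.
Qed.

Lemma image_graph_copies (T : finType) (H : graph T) n (y0 : 'I_n) (U : {set 'I_n}) :
  [set image_graph H f | f in embeddings H y0 U] =
  [set graph_val G | G in copies_in H U].
Proof.
apply/setP => g; apply/imsetP/imsetP => [[f /embeddingsP[fI fU f0] ->]|[G]].
  have wf : wf_graph (image_graph H f).
    apply/forallP => e'; apply/implyP => /imsetP[e eH ->].
    rewrite card_in_imset ?(edge_card eH) ?eqxx ?imsetS ?(edge_sub eH) //.
    by move=> x y xe ye; apply: fI; apply: (subsetP (edge_sub eH)).
  exists (Graph wf) => //; rewrite !inE; apply/andP; split; last by [].
  apply/andP; split; first by rewrite /subgraph subsetT copy_edges_sub.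
  apply/existsP; exists f; apply/and3P; split => //.
  apply/forallP => x; apply/implyP => xV; apply/forallP => y; apply/implyP => yV.
  by apply/implyP => /eqP fxy; apply/eqP/fI.
rewrite inE => /andP[/copyP[f [fI fV fE]] GU] ->.
pose f' := [ffun x => if x \in vertices H then f x else y0].
have f'E : {in vertices H, f' =1 f} by move=> x xV; rewrite ffunE xV.
have f'V (A : {set T}) : A \subset vertices H -> f' @: A = f @: A.
  by move=> AV; apply: eq_in_imset => x /(subsetP AV); apply: f'E.
exists f'.
  apply/embeddingsP; split.
  - by move=> x y xV yV; rewrite !f'E //; apply: fI.
  - by rewrite f'V // fV.
  - by move=> x /negbTE xV; rewrite ffunE xV.
rewrite /image_graph f'V // fV.
have -> : [set f' @: (e : {set T}) | e in edges H] = [set f @: (e : {set T}) | e in edges H].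
  by apply: eq_in_imset => e /edge_sub/f'V.
by rewrite fE /vertices /edges; case: (graph_val G).
Qed.

(** Restriction to the subtype of vertices of [H] is a bijection onto the injections into [U]; its
    inverse [ext] fills in the default [y0]. *)
Lemma card_embeddings (T : finType) (H : graph T) n (y0 : 'I_n) (U : {set 'I_n}) :
  #|embeddings H y0 U| = #|U| ^_ (nverts H).
Proof.
pose D := {x : T | x \in vertices H}.
pose ext (g : {ffun D -> 'I_n}) : {ffun T -> 'I_n} :=
  [ffun x => if insub x is Some u then g u else y0].
have extE g (u : D) : ext g (val u) = g u by rewrite ffunE valK.
have extI : injective ext.
  by move=> g g' /ffunP E; apply/ffunP => u; rewrite -!extE E.
have <- : #|[set: D]| = nverts H by rewrite cardsT card_sig; apply: eq_card.
rewrite cardsT -card_inj_ffuns_on -(card_imset _ extI).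
apply: eq_card => f; apply/embeddingsP/imsetP => [[fI fU f0]|[g]].
  exists [ffun u => f (val u)].
    rewrite inE; apply/andP; split.
      by apply/ffun_onP => u; rewrite ffunE (subsetP fU) // imset_f // (valP u).
    by apply/injectiveP => u u'; rewrite !ffunE => /fI E; apply/val_inj/E; apply: valP.
  apply/ffunP => x; rewrite ffunE; case: insubP => [u xV <-|/f0 ->] //.
  by rewrite ffunE.
rewrite inE => /andP[/ffun_onP gU /injectiveP gI] ->; split.
- move=> x y xV yV.
  by rewrite -[x]/(val (Sub x xV : D)) -[y]/(val (Sub y yV : D)) !extE => /gI ->.
- apply/subsetP => z /imsetP[x xV ->].
  by rewrite -[x]/(val (Sub x xV : D)) extE gU.
- by move=> x xV; rewrite ffunE insubN.
Qed.

(** The embeddings with the same image as [f0] are exactly the composites of [f0] with the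
    automorphisms of [H], without repetition. *)
Lemma card_embeddings_fibre (T : finType) (H : graph T) n (y0 : 'I_n) (U : {set 'I_n}) f0 :
  f0 \in embeddings H y0 U ->
  #|[set f in embeddings H y0 U | image_graph H f == image_graph H f0]| = nauto H.
Proof.
move=> /embeddingsP[fI fU f00].
pose c (s : {perm T}) : {ffun T -> 'I_n} := [ffun x => f0 (s x)].
have memV s x : perm_on (vertices H) s -> (s x \in vertices H) = (x \in vertices H).
  by move=> sV; apply: perm_closed.
have cI : {in automorphisms H &, injective c}.
  move=> s s'; rewrite !inE => /andP[sV _] /andP[s'V _] /ffunP E.
  apply/permP => x; have [xV|xV] := boolP (x \in vertices H).
    by apply: fI; rewrite ?memV //; have := E x; rewrite !ffunE.
  by rewrite !(out_perm _ xV).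
rewrite /nauto -(card_in_imset cI); apply: eq_card => f.
rewrite inE; apply/andP/imsetP => [[/embeddingsP[gI gU g0] /eqP[EV EE]]|[s]].
  (* On the vertices of [H] this is the inverse of [f0] applied to [f x]; elsewhere it is the
     identity, as the representation of automorphisms requires. *)
  pose g x := odflt x [pick y in vertices H | (x \in vertices H) && (f0 y == f x)].
  have gP x : x \in vertices H -> g x \in vertices H /\ f0 (g x) = f x.
    move=> xV; rewrite /g; case: pickP => [y /and3P[yV _ /eqP] //|none].
    have : f x \in f0 @: vertices H by rewrite -EV imset_f.
    by case/imsetP => y yV fxy; have := none y; rewrite yV xV fxy eqxx.
  have gN x : x \notin vertices H -> g x = x.
    by move=> /negbTE xV; rewrite /g; case: pickP => // y; rewrite xV andbF.
  have ginj : injective g.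
    move=> x y; have [xV|xV] := boolP (x \in vertices H); have [yV|yV] := boolP (y \in vertices H).
    - by move=> E; apply: gI => //; rewrite -(gP x xV).2 -(gP y yV).2 E.
    - by rewrite (gN y yV) => E; move: yV; rewrite -E (gP x xV).1.
    - by rewrite (gN x xV) => E; move: xV; rewrite E (gP y yV).1.
    - by rewrite !gN.
  pose s := perm ginj.
  have sV : perm_on (vertices H) s.
    apply/subsetP => x; rewrite inE permE; apply: contraR => xV; apply/eqP; exact: gN.
  have f0s (e : {set T}) : e \subset vertices H -> f0 @: (s @: e) = f @: e.
    move=> eV; rewrite -imset_comp; apply: eq_in_imset => x /(subsetP eV) xV /=.
    by rewrite permE (gP x xV).2.
  exists s; last first.
    apply/ffunP => x; rewrite ffunE permE; have [xV|xV] := boolP (x \in vertices H).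
      by rewrite (gP x xV).2.
    by rewrite gN // g0 // f00.
  (* A permutation preserves the number of edges, so one inclusion between the edge sets
     suffices. *)
  rewrite inE sV /= eqEcard; apply/andP; split; last first.
    by rewrite card_imset //; apply: imset_inj; apply: perm_inj.
  apply/subsetP => e' /imsetP[e eH ->].
  have : f @: e \in [set f0 @: (e : {set T}) | e in edges H] by rewrite -EE imset_f.
  case/imsetP => e2 e2H; rewrite -f0s ?edge_sub // => E.
  suff -> : s @: e = e2 by [].
  apply: (imset_inj_sub fI) E; last exact: edge_sub.
  by apply/subsetP => y /imsetP[x xe ->]; rewrite memV // (subsetP (edge_sub eH)).
rewrite inE => /andP[sV /eqP sE] ->.
have cV (e : {set T}) : c s @: e = f0 @: (s @: e).
  by rewrite -imset_comp; apply: eq_imset => x; rewrite /= ffunE.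
have sVV : s @: vertices H = vertices H by apply: im_perm_on.
split.
  apply/embeddingsP; split.
  - by move=> x y xV yV; rewrite !ffunE => /fI E; apply: (@perm_inj _ s); apply: E; rewrite memV.
  - by rewrite cV sVV.
  - by move=> x xV; rewrite ffunE (out_perm sV xV) f00.
rewrite /image_graph cV sVV; apply/eqP; congr (_, _).
rewrite -[in RHS]sE -imset_comp; apply: eq_imset => e /=; exact: cV.
Qed.

(** Embeddings into [U] are counted by their images: every copy is the image of exactly [nauto H] of
    them. Positivity of [n] supplies the default value [y0]. *)
Lemma card_copies_in (T : finType) (H : graph T) n (U : {set 'I_n}) :
  (0 < n)%N -> (#|copies_in H U| * nauto H)%N = #|U| ^_ (nverts H).
Proof.
move=> n0; pose y0 := Ordinal n0.
rewrite -(card_embeddings H y0) -[RHS]sum1_card.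
rewrite (partition_big_imset (@image_graph T H n)) image_graph_copies big_imset; last first.
  by move=> G G' _ _; apply: val_inj.
rewrite /= (eq_bigr (fun=> nauto H)) ?sum_nat_const // => G Gc.
have : graph_val G \in [set graph_val G | G in copies_in H U] by rewrite imset_f.
rewrite -(image_graph_copies H y0) => /imsetP[f0 f0e ->].
rewrite -(card_embeddings_fibre f0e) -sum1_card; apply: eq_bigl => f.
by rewrite inE.
Qed.

Lemma nauto_gt0 (T : finType) (H : graph T) : (0 < nauto H)%N.
Proof.
apply/card_gt0P; exists 1%g; rewrite inE perm_on1 /=; apply/eqP.
rewrite -[RHS]imset_id; apply: eq_imset => e /=; rewrite -[RHS]imset_id.
by apply: eq_imset => x; rewrite perm1.
Qed.

(** Crude on purpose: a vertex set is a subset of [S] and an edge set is a family of subsets of [S].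
    What matters is that the bound depends on [#|S|] alone. *)
Lemma card_graphs_on (T : finType) (S : {set T}) :
  (#|[set G : graph T | vertices G \subset S]| <= 2 ^ #|S| * 2 ^ (2 ^ #|S|))%N.
Proof.
rewrite -(card_imset _ val_inj) -2!card_powerset -cardsX; apply/subset_leq_card/subsetP => g /imsetP[G].
rewrite inE => GS ->; have := @edge_sub _ G; move: GS; rewrite /vertices /edges /=.
case: (graph_val G) => V E /= VS EV; rewrite !inE VS /=.
by apply/subsetP => e eE; rewrite inE (subset_trans (EV _ eE)).
Qed.

(** Pairs are grouped by the union [S] of their vertex sets. There are at most [#|U| ^ j] choices of
    [S], and the number of pairs for each is bounded independently of [U]. *)
Lemma card_graph_pairs_on (T : finType) (U : {set T}) j :
  (#|[set p : graph T * graph T | (vertices p.1 :|: vertices p.2 \subset U)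
        && (#|vertices p.1 :|: vertices p.2| == j)]|
    <= (2 ^ j * 2 ^ (2 ^ j)) ^ 2 * #|U| ^ j)%N.
Proof.
rewrite -sum1_card.
rewrite (partition_big (fun p : graph T * graph T => vertices p.1 :|: vertices p.2)
   (fun S => (S \subset U) && (#|S| == j))) /=; last by move=> p; rewrite inE.
apply: (@leq_trans (\sum_(S : {set T} | (S \subset U) && (#|S| == j)) (2 ^ j * 2 ^ (2 ^ j)) ^ 2)%N).
  apply: leq_sum => S /andP[SU /eqP Sj].
  rewrite sum1_card -Sj -mulnn.
  apply: leq_trans (leq_mul (card_graphs_on S) (card_graphs_on S)).
  rewrite -cardsX; apply/subset_leq_card/subsetP => p; rewrite !inE => /andP[_ /eqP <-].
  by rewrite subsetUl subsetUr.
rewrite sum_nat_const mulnC leq_mul2l; apply/orP; right.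
have -> : #|[pred S : {set T} | (S \subset U) && (#|S| == j)]| = 'C(#|U|, j).
  by rewrite -cards_draws; apply: eq_card => S; rewrite !inE.
apply: leq_trans (_ : #|U| ^_ j <= _)%N; first by rewrite -bin_ffact leq_pmulr ?fact_gt0.
rewrite ffact_prod -[j in (_ ^ j)%N]card_ord -prod_nat_const.
by apply: leq_prod => i _; apply: leq_subr.
Qed.

From mathcomp Require Import all_classical all_reals all_analysis.
From mathcomp Require Import measurable_realfun lra ring zify.
Import numFieldNormedType.Exports.
Local Open Scope classical_set_scope.
Local Open Scope ring_scope.

(** * Independence and the sieve *)

Section RealProbability.
Context {R : realType} {d : measure_display} {T : measurableType d}.
Variable P : probability T R.
Implicit Types A B C : set T.

Definition pr A : R := fine (P A).

Lemma prE A : measurable A -> P A = (pr A)%:E.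
Proof. by move=> mA; rewrite /pr fineK // fin_num_measure. Qed.

Lemma pr_ge0 A : 0 <= pr A.
Proof. exact: fine_ge0. Qed.

Lemma pr_le1 A : measurable A -> pr A <= 1.
Proof. by move=> mA; rewrite -lee_fin -prE // probability_le1. Qed.

Lemma pr_setT : pr setT = 1.
Proof. by rewrite /pr probability_setT. Qed.

Lemma pr_set0 : pr set0 = 0.
Proof. by rewrite /pr measure0. Qed.

Lemma le_pr A B : measurable A -> measurable B -> A `<=` B -> pr A <= pr B.
Proof. by move=> mA mB AB; rewrite -lee_fin -!prE // le_measure ?inE. Qed.

Lemma pr_split A B : measurable A -> measurable B ->
  pr A = pr (A `&` B) + pr (A `&` ~` B).
Proof.
move=> mA mB; apply/EFin_inj; rewrite EFinD -!prE //; try exact: measurableI.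
- rewrite -measureU //; first by rewrite -setIUr setUv setIT.
  + exact: measurableI.
  + by apply: measurableI => //; apply: measurableC.
  + by rewrite setIACA setICr setI0.
- by apply: measurableI => //; apply: measurableC.
Qed.

Lemma pr_setU_le A B : measurable A -> measurable B ->
  pr (A `|` B) <= pr A + pr B.
Proof.
move=> mA mB; rewrite -lee_fin EFinD -!prE //; last exact: measurableU.
exact: measureU2.
Qed.

Lemma pr_bigcup_le (I : Type) (s : seq I) (Q : pred I) (F : I -> set T) :
  (forall i, measurable (F i)) ->
  pr (\big[setU/set0]_(i <- s | Q i) F i) <= \sum_(i <- s | Q i) pr (F i).
Proof.
move=> mF; elim: s => [|i s IH]; first by rewrite !big_nil pr_set0.
rewrite !big_cons; case: ifP => // _.
apply: le_trans (pr_setU_le _ _) _ => //; last by rewrite lerD2l.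
exact: bigsetU_measurable.
Qed.

Lemma pr_disjoint_sum (I : choiceType) (s : seq I) (F : I -> set T) A :
  uniq s -> (forall i, measurable (F i)) -> measurable A ->
  trivIset [set` s] F -> (forall i, i \in s -> F i `<=` A) ->
  \sum_(i <- s) pr (F i) <= pr A.
Proof.
move=> us mF mA tF FA; elim: s us A mA tF FA => [|i s IH] /=.
  by move=> _ A _ _ _; rewrite big_nil pr_ge0.
case/andP => nis us A mA tF FA; rewrite big_cons (pr_split mA (mF i)) lerD //.
  apply: le_pr => //; first exact: measurableI.
  by move=> x Fx; split => //; apply: (FA i) => //; rewrite mem_head.
apply: IH => //.
- by apply: measurableI => //; apply: measurableC.
- by apply: sub_trivIset tF => j /= js; rewrite inE js orbT.
- move=> j js x Fx; split; first by apply: (FA j) => //; rewrite inE js orbT.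
  move=> Fix; move: nis; rewrite (tF i j) ?js //=; first by rewrite mem_head.
    by rewrite inE js orbT.
  by exists x.
Qed.

End RealProbability.

Section Independence.
Context {R : realType} {d : measure_display} {T : measurableType d}.
Variables (P : probability T R) (I : finType) (w : I -> {RV P >-> R}).
Implicit Types J : {set I}.

(** Measurable boxes in the coordinates [J]. They are closed under intersection and generate the
    sigma-algebra of the variables indexed by [J], so measures that agree on them agree on
    [sigma_rv J]. *)
Definition cylinders J : set (set T) :=
  [set A | exists2 B : I -> set R, (forall i, measurable (B i)) &
     A = \bigcap_(i in [set` J]) (w i @^-1` B i)].

Definition sigma_rv J : set (set T) := <<s cylinders J >>.

Lemma measurable_preimage_rv (i : I) (B : set R) : measurable B -> measurable (w i @^-1` B).
Proof. by move=> mB; rewrite -[X in measurable X]setTI; apply: measurable_funPT. Qed.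

Lemma cylinders_measurable J : cylinders J `<=` measurable.
Proof.
move=> _ [B mB ->]; apply: fin_bigcap_measurable => [|i _]; first exact: finite_finset.
exact: measurable_preimage_rv.
Qed.

Lemma sigma_rv_measurable J A : sigma_rv J A -> measurable A.
Proof.
apply: smallest_sub; [exact: sigma_algebra_measurable|exact: cylinders_measurable].
Qed.

Lemma setI_closed_cylinders J : setI_closed (cylinders J).
Proof.
move=> _ _ [B mB ->] [B' mB' ->]; exists (fun i => B i `&` B' i).
  by move=> i; apply: measurableI.
apply/seteqP; split => [t [h h'] i iJ|t h]; first by split; [exact: h|exact: h'].
by split => i iJ; have [] := h i iJ.
Qed.

Lemma cylinders_setT J : cylinders J setT.
Proof.
exists (fun=> setT) => //; apply/esym/seteqP; split => // t _ i _ /=.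
Qed.

Lemma cylinders_independent D J J' A A' :
  independent_in D w -> J \subset D -> J' \subset D -> [disjoint J & J']%B ->
  cylinders J A -> cylinders J' A' -> P (A `&` A') = (P A * P A')%E.
Proof.
move=> ind JD J'D dJ [B mB ->] [B' mB' ->].
rewrite !ind //.
pose C i := if i \in J then B i else B' i.
have nJ i : i \in J' -> (i \in J) = false.
  by move=> iJ'; apply/negbTE/negP => iJ; move/disjointFr: dJ => /(_ _ iJ); rewrite iJ'.
have -> : \bigcap_(i in [set` J]) (w i @^-1` B i) `&` \bigcap_(i in [set` J']) (w i @^-1` B' i)
        = \bigcap_(i in [set` J :|: J']) (w i @^-1` C i).
  apply/seteqP; split => [t [h h'] i /=|t h].
    rewrite inE /C; case: ifPn => [iJ _|iJ /= iJ']; [exact: h|exact: h'].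
  split => i /= iJ; have /= := h i; rewrite /C inE iJ ?orbT /=; first by apply.
  by rewrite nJ //; apply.
rewrite ind; last 2 first.
- by rewrite finset.subUset JD.
- by move=> i _; rewrite /C; case: ifP.
rewrite (eq_bigl (fun i => (i \in J) || (i \in J'))); last by move=> i; rewrite inE.
rewrite bigU //=; congr (_ * _)%E; apply: eq_bigr => i iJ; rewrite /C ?iJ //.
by rewrite nJ.
Qed.

(** For a fixed event [C], the maps [E] to [P (C & E)] and [E] to [P C * P E] are finite measures;
    if they agree on the cylinders, they agree on the generated sigma-algebra. This extends
    independence one factor at a time. *)
Lemma sigma_rv_independent D J J' A A' :
  independent_in D w -> J \subset D -> J' \subset D -> [disjoint J & J']%B ->
  sigma_rv J A -> sigma_rv J' A' -> pr P (A `&` A') = pr P A * pr P A'.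
Proof.
move=> ind JD J'D dJ sA sA'.
have key K (C : set T) (mC : measurable C) : (forall E, cylinders K E -> P (C `&` E) = (P C * P E)%E) ->
    forall E, sigma_rv K E -> P (C `&` E) = (P C * P E)%E.
  move=> h E sE.
  have nn : 0 <= pr P C by apply: pr_ge0.
  transitivity (mrestr P mC E); first by rewrite /mrestr setIC.
  transitivity (mscale (NngNum nn) P E); last by rewrite /mscale /= (prE P mC).
  apply: (@g_sigma_algebra_measure_unique _ _ _ (cylinders K) _ (fun=> setT)) sE => //.
  - exact: cylinders_measurable.
  - by move=> _; apply: cylinders_setT.
  - exact: bigcup_const.
  - exact: setI_closed_cylinders.
  - move=> F cF; transitivity (P (F `&` C)) => //; rewrite setIC h // (prE P mC) //.
  - move=> k; apply: (@le_lt_trans _ _ (P C)); last by rewrite (prE P mC) ltry.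
    by apply: le_measure; rewrite ?inE //; exact: measurableI.
have mA := sigma_rv_measurable sA; have mA' := sigma_rv_measurable sA'.
apply/EFin_inj; rewrite EFinM -!(prE P) //; last exact: measurableI.
(* First the second event is reduced to a cylinder, with [A] fixed; then [A] is reduced to a
   cylinder, with that one fixed. *)
apply: (key J') => // E cE.
have mE := cylinders_measurable cE.
rewrite setIC muleC; apply: (key J) => // F cF.
rewrite setIC muleC; exact: (cylinders_independent ind JD J'D dJ).
Qed.

Lemma sigma_rv_sigma_algebra J : sigma_algebra setT (sigma_rv J).
Proof. exact: smallest_sigma_algebra. Qed.

Lemma sigma_rvC J A : sigma_rv J A -> sigma_rv J (~` A).
Proof. by move=> sA; rewrite -setTD; case: (sigma_rv_sigma_algebra J) => _ h _; apply: h. Qed.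

Lemma sigma_rv_bigcap J (K : Type) (s : seq K) (Q : pred K) (F : K -> set T) :
  (forall k, Q k -> sigma_rv J (F k)) -> sigma_rv J (\big[setI/setT]_(k <- s | Q k) F k).
Proof.
move=> h; apply: (@bigsetI_measurable _ (g_sigma_algebraType (cylinders J))) => k Qk.
exact: h.
Qed.

Lemma sigma_rv_rv J i (B : set R) : i \in J -> measurable B ->
  sigma_rv J (w i @^-1` B).
Proof.
move=> iJ mB; apply: sub_sigma_algebra.
exists (fun j => if j == i then B else setT); first by move=> j; case: ifP.
apply/seteqP; split => [t Bt j jJ /=|t h].
  by case: eqP => [->|].
by have /= := h i iJ; rewrite eqxx.
Qed.

Lemma sigma_rv_sum J (E : {set I}) (B : set R) : E \subset J -> measurable B ->
  sigma_rv J ((fun t => \sum_(e in E) w e t) @^-1` B).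
Proof.
move=> /fintype.subsetP EJ mB.
suff : measurable_fun (setT : set (g_sigma_algebraType (cylinders J)))
   (fun t : T => \sum_(e in E) w e t).
  by move=> /(_ measurableT B mB); rewrite setTI.
(* [measurable_sum] wants every member of the family measurable for the small sigma-algebra, so the
   variables outside [J] are replaced by 0. *)
have -> : (fun t : T => \sum_(e in E) w e t) =
   (fun t => \sum_(e <- enum E) (if e \in J then (w e : T -> R) else cst 0) t).
  apply/funext => t; rewrite big_enum; apply: eq_bigr => e /EJ -> //.
apply: (@measurable_sum _ (g_sigma_algebraType (cylinders J)) R setT I (enum E)
   (fun e => (if e \in J then (w e : T -> R) else cst 0))) => e.
case: ifPn => [eJ|_]; last exact: measurable_cst.
by move=> _ C mC; rewrite setTI; apply: sigma_rv_rv.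
Qed.

End Independence.

Section Sieve.
Context {R : realType} {d : measure_display} {T : measurableType d}.
Variables (P : probability T R) (I : choiceType) (A : I -> set T) (adj : rel I).
Hypothesis mA : forall i, measurable (A i).

Definition none (s : seq I) : set T := \big[setI/setT]_(i <- s) ~` A i.

Lemma none_measurable s : measurable (none s).
Proof. by apply: bigsetI_measurable => i _; apply: measurableC. Qed.

Lemma noneP s t : none s t <-> forall i, i \in s -> ~ A i t.
Proof.
rewrite /none; elim: s => [|i s IH]; first by rewrite big_nil; split.
rewrite big_cons; split=> [[ti /IH h] j|h].
  by rewrite inE => /predU1P[->|/h].
split; first by apply: h; rewrite mem_head.
by apply/IH => j js; apply: h; rewrite inE js orbT.
Qed.

(* Bonferroni-type bound obtained by removing the events one at a time: [A i] is
   independent of the absence of its later non-neighbours, and these differ from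
   all later events only by neighbours of [i]. *)
Lemma sieve s : uniq s ->
  (forall i l, i \notin l -> i \in s -> {subset l <= s} -> all (fun j => ~~ adj i j) l ->
     pr P (A i `&` none l) = pr P (A i) * pr P (none l)) ->
  `|pr P (none s) - \prod_(i <- s) (1 - pr P (A i))| <=
  \sum_(i <- s) \sum_(j <- s | (j != i) && adj i j)
     (pr P (A i) * pr P (A j) + pr P (A i `&` A j)).
Proof.
have mN := none_measurable.
have mAA i j : measurable (A i `&` A j) by exact: measurableI.
have mAN i s' : measurable (A i `&` none s') by exact: measurableI.
have t0 i j : 0 <= pr P (A i) * pr P (A j) + pr P (A i `&` A j).
  by rewrite addr_ge0 ?mulr_ge0 ?pr_ge0.
elim: s => [|i s IH] /=; first by rewrite /none !big_nil pr_setT subrr normr0.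
case/andP => nis us ind.
have {}IH := IH us (fun i' l nil i's ls al => ind i' l nil (mem_behead (s := i :: s) i's)
    (fun j jl => mem_behead (s := i :: s) (ls j jl)) al).
set p := pr P (A i).
have p0 : 0 <= p := pr_ge0 _ _.
have p1 : p <= 1 := pr_le1 _ (mA i).
set e := \sum_(j <- s | (j != i) && adj i j) (p * pr P (A j) + pr P (A i `&` A j)).
pose Q j := (j != i) && adj i j.
(* The later events not adjacent to [A i]; their joint absence is independent of [A i]. *)
pose l := seq.filter (predC Q) s.
have nil : i \notin l by rewrite mem_filter (negbTE nis) andbF.
have indl : pr P (A i `&` none l) = p * pr P (none l).
  apply: ind => //; first by rewrite mem_head.
    by move=> j; rewrite mem_filter => /andP[_ js]; rewrite inE js orbT.
  apply/allP => j; rewrite mem_filter /= /Q => /andP[+ js].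
  by rewrite (memPn nis) ?js.
have sl : none s `<=` none l.
  by move=> t /noneP h; apply/noneP => j; rewrite mem_filter => /andP[_ /h].
have ls : none l `<=` none s `|` \big[setU/set0]_(j <- s | Q j) A j.
  move=> t /noneP h; have [|/noneP hs] := pselect (none s t); first by left.
  right; rewrite -bigcup_seq_cond.
  have [j [js Aj]] : exists j, j \in s /\ A j t.
    apply: contrapT => hn; apply: hs => j js Aj; apply: hn; by exists j.
  exists j => //=; rewrite js /=; apply: contrapT => /negP nQ.
  by apply: (h j) => //; rewrite mem_filter /= nQ.
have mU : measurable (\big[setU/set0]_(j <- s | Q j) A j) by exact: bigsetU_measurable.
have mU' : measurable (\big[setU/set0]_(j <- s | Q j) (A i `&` A j)) by exact: bigsetU_measurable.
(* The bounds [b0] to [b3] compare both [p * pr P (none s)] and [pr P (A i & none s)] with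
   [p * pr P (none l)]. Each differs from it by at most the corresponding sum over the neighbours of
   [i]. *)
have b0 : pr P (none s) <= pr P (none l) by exact: le_pr.
have b1 : pr P (none l) <= pr P (none s) + \sum_(j <- s | Q j) pr P (A j).
  apply: (le_trans (le_pr _ _ _ ls)) => //; first exact: measurableU.
  by apply: (le_trans (pr_setU_le _ _ _)) => //; rewrite lerD2l pr_bigcup_le.
have b2 : pr P (A i `&` none s) <= p * pr P (none l).
  by rewrite -indl; apply: le_pr => // t [? /sl].
have b3 : p * pr P (none l) <= pr P (A i `&` none s) + \sum_(j <- s | Q j) pr P (A i `&` A j).
  rewrite -indl.
  have sub : A i `&` none l `<=` (A i `&` none s) `|` \big[setU/set0]_(j <- s | Q j) (A i `&` A j).
    move=> t [Ait /ls[ns|]]; first by left.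
    by rewrite -!bigcup_seq_cond => -[j js Ajt]; right; exists j.
  apply: (le_trans (le_pr _ _ _ sub)) => //; first exact: measurableU.
  by apply: (le_trans (pr_setU_le _ _ _)) => //; rewrite lerD2l pr_bigcup_le.
have eE : e = p * \sum_(j <- s | Q j) pr P (A j) + \sum_(j <- s | Q j) pr P (A i `&` A j).
  by rewrite mulr_sumr -big_split.
have S0 : 0 <= \sum_(j <- s | Q j) pr P (A j) by apply: sumr_ge0 => j _; exact: pr_ge0.
have S1 : 0 <= \sum_(j <- s | Q j) pr P (A i `&` A j) by apply: sumr_ge0 => j _; exact: pr_ge0.
have NE : pr P (none (i :: s)) = pr P (none s) - pr P (A i `&` none s).
  rewrite (pr_split P (mN s) (mA i)) /none big_cons [in RHS]setIC addrAC subrr add0r.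
  by rewrite setIC.
rewrite [X in _ <= X]big_cons [X in _ <= X + _]big_cons eqxx /= -/p -/e.
(* In the inner sums for later indices, the terms that pair them with [i] are non-negative and are
   dropped. *)
apply: (@le_trans _ _ (e + \sum_(i0 <- s) \sum_(j <- s | (j != i0) && adj i0 j)
     (pr P (A i0) * pr P (A j) + pr P (A i0 `&` A j)))); last first.
  rewrite lerD2l; apply: ler_sum => j _; rewrite big_cons; case: ifP => // _.
  by rewrite lerDr.
rewrite big_cons NE -/p.
move: IH; set E := \sum_(i0 <- s) _; set pi := \prod_(j <- s) _; set N := pr P (none s) => IH.
set X := pr P (A i `&` none s).
(* The first summand is the error made by removing [A i]; the second is the inductive error, shrunk
   by the factor [1 - p]. *)
have -> : N - X - (1 - p) * pi = (p * N - X) + (1 - p) * (N - pi) by ring.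
apply: le_trans (ler_normD _ _) _; apply: lerD.
  move: b0 b1 b2 b3; rewrite -/N -/X => b0 b1 b2 b3.
  rewrite ler_norml eE; apply/andP; split.
    have := ler_wpM2l p0 b1; rewrite mulrDr => h.
    lra.
  have := ler_wpM2l p0 b0.
  have := mulr_ge0 p0 S0; lra.
rewrite normrM ger0_norm ?subr_ge0 //.
apply: le_trans IH; rewrite ler_piMl ?normr_ge0 //; lra.
Qed.

End Sieve.

(** Factors are exchanged one at a time. Each exchange costs at most [p i ^+ 2], since [1 - q] and
    [exp (- q)] differ by at most [q ^+ 2] and all remaining factors lie in [[0, 1]]. *)
Lemma prod_onem_expR (R : realType) (I : Type) (s : seq I) (p : I -> R) :
  (forall i, 0 <= p i <= 1) ->
  `|\prod_(i <- s) (1 - p i) - expR (- \sum_(i <- s) p i)| <= \sum_(i <- s) p i ^+ 2.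
Proof.
move=> p01; elim: s => [|i s IH]; first by rewrite !big_nil oppr0 expR0 subrr normr0.
rewrite !big_cons opprD expRD.
move: IH; set pi := \prod_(j <- s) _; set S := \sum_(j <- s) p j; set E := \sum_(j <- s) _.
move=> IH; have /andP[p0 p1] := p01 i; set q := p i in p0 p1 *.
have S0 : 0 <= S by apply: sumr_ge0 => j _; have /andP[] := p01 j.
have -> : (1 - q) * pi - expR (- q) * expR (- S) =
   ((1 - q) - expR (- q)) * expR (- S) + (1 - q) * (pi - expR (- S)) by ring.
apply: le_trans (ler_normD _ _) _; apply: lerD.
  rewrite normrM [X in _ * X]ger0_norm ?expR_ge0 //.
  apply: (@le_trans _ _ `|1 - q - expR (- q)|).
    by rewrite ler_piMr ?normr_ge0 // expR_le1 oppr_le0.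
  have h1 : 1 - q <= expR (- q) by have := expR_ge1Dx (- q).
  have h2 : expR (- q) * (1 + q) <= 1.
    rewrite expRN; have := expR_ge1Dx q => h.
    by rewrite ler_pdivrMl ?expR_gt0 // mulr1.
  rewrite ler_norml; apply/andP; split; last by have := sqr_ge0 q; lra.
  (* The right side equals [1 + q ^+ 3], while the left side is at most 1; dividing by [1 + q]
     bounds [exp (- q)] above. *)
  have : expR (- q) * (1 + q) <= (1 - q + q ^+ 2) * (1 + q).
    apply: (le_trans h2); rewrite (_ : _ * _ = 1 + q ^+ 3); last by ring.
    by rewrite lerDl exprn_ge0.
  rewrite ler_pM2r; lra.
rewrite normrM ger0_norm ?subr_ge0 //.
by apply: le_trans IH; rewrite ler_piMl ?normr_ge0 //; lra.
Qed.

Lemma expR_lipschitz (R : realType) (a b : R) : 0 <= a -> 0 <= b ->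
  `|expR (- a) - expR (- b)| <= `|a - b|.
Proof.
wlog ab : a b / a <= b => [W a0 b0|a0 b0].
  have [ab|/ltW ba] := leP a b; first exact: W.
  by rewrite distrC [X in _ <= X]distrC; apply: W.
have h : expR (- b) <= expR (- a) by rewrite ler_expR lerN2.
rewrite ger0_norm ?subr_ge0 // distrC ger0_norm ?subr_ge0 //.
have -> : expR (- b) = expR (- a) * expR (- (b - a)) by rewrite -expRD; congr expR; ring.
have e1 : expR (- a) <= 1 by rewrite expR_le1 oppr_le0.
have := expR_ge1Dx (- (b - a)) => h2.
have e0 := expR_ge0 (- a).
have h3 : 0 <= 1 - expR (- (b - a)) by rewrite subr_ge0 expR_le1 oppr_le0 subr_ge0.
have -> : expR (- a) - expR (- a) * expR (- (b - a)) = expR (- a) * (1 - expR (- (b - a))) by ring.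
have := ler_wpM2r h3 e1; lra.
Qed.

(** * Sums of independent weights near zero *)

Lemma expr_succ_bounds (R : realDomainType) (x : R) k : 0 <= x ->
  k.+1%:R * x ^+ k <= (x + 1) ^+ k.+1 - x ^+ k.+1 <= k.+1%:R * (x + 1) ^+ k.
Proof.
move=> x0; elim: k => [|k /andP[IH1 IH2]].
  by rewrite !expr1 !expr0 mulr1; apply/andP; split; lra.
have xk : x ^+ k.+1 <= (x + 1) ^+ k.+1 by rewrite lerXn2r ?nnegrE //; lra.
have x10 : 0 <= x + 1 by lra.
have h1 := ler_wpM2l x10 IH1; have h2 := ler_wpM2l x10 IH2.
have k0 : 0 <= k.+1%:R * x ^+ k by rewrite mulr_ge0 // exprn_ge0.
rewrite (exprS (x + 1) k.+1) [x ^+ k.+2]exprS.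
rewrite (exprS (x + 1) k) [x ^+ k.+1]exprS in xk h1 h2 *.
rewrite -[k.+2%:R]natr1.
by apply/andP; split; lra.
Qed.

(** Telescoping [expr_succ_bounds] gives the Riemann sum of [x ^ k]: its main term is
    [n ^ (k + 1) / (k + 1)] and its error is [O (n ^ k)]. *)
Lemma sum_expr_bounds (R : realFieldType) k (n : nat) :
  (n%:R : R) ^+ k.+1 <= k.+1%:R * (\sum_(i < n) i.+1%:R ^+ k)
    <= (n%:R : R) ^+ k.+1 + k.+1%:R * n%:R ^+ k.
Proof.
elim: n => [|n /andP[IH1 IH2]].
  by rewrite big_ord0 mulr0 expr0n /= lexx add0r mulr_ge0 // exprn_ge0.
rewrite big_ord_recr /= mulrDr.
have /andP[h1 h2] := expr_succ_bounds k (ler0n R n).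
rewrite natr1 in h1 h2.
by apply/andP; split; lra.
Qed.

(** Besides [a * c], each expansion has seven monomials, all of absolute value at most [t]; this is
    the constant 7. *)
Lemma triple_product_bounds (R : realFieldType) (t a c : R) :
  0 <= t -> t <= 1 -> 0 <= a <= 1 -> 0 <= c <= 1 ->
  (1 + t) * (a + t) * (c + t) <= a * c + 7 * t /\
  a * c - 7 * t <= (1 - t) * (a - t) * (c - t).
Proof.
move=> t0 t1 /andP[a0 a1] /andP[c0 c1].
have le1 (x : R) : 0 <= x <= 1 -> 0 <= t * x <= t.
  by case/andP => x0 x1; rewrite mulr_ge0 //= ler_piMr.
have mul1 (x y : R) : 0 <= x <= 1 -> 0 <= y <= 1 -> 0 <= x * y <= 1.
  by case/andP => x0 x1 /andP[y0 y1]; rewrite mulr_ge0 //= mulr_ile1.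
have a01 : 0 <= a <= 1 by rewrite a0.
have c01 : 0 <= c <= 1 by rewrite c0.
have t01 : 0 <= t <= 1 by rewrite t0.
have /andP[? ?] := le1 _ a01; have /andP[? ?] := le1 _ c01.
have /andP[? ?] := le1 _ (mul1 _ _ a01 c01).
have /andP[? ?] := le1 _ t01.
have /andP[? ?] := le1 _ (mul1 _ _ t01 a01).
have /andP[? ?] := le1 _ (mul1 _ _ t01 c01).
have /andP[? ?] := le1 _ (mul1 _ _ t01 t01).
by split; lra.
Qed.

Section SumAsymptotics.
Context {R : realType} {d0 : measure_display} {Omega0 : measurableType d0}.
Context {P0 : probability Omega0 R} (X : {RV P0 >-> R}).
Hypothesis X_ge0 : forall t, 0 <= X t.
Hypothesis F_cont : continuous (dist_fun X).
Hypothesis F_slope : has_right_derivative (dist_fun X) 0 1.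

Local Notation F := (dist_fun X).

Lemma dist_funE x : F x = pr P0 (X @^-1` `]-oo, x]).
Proof. by []. Qed.

(** [F] vanishes at negative arguments because [X] is non-negative, and continuity passes this to 0.
    In particular [X] is almost surely positive. *)
Lemma dist_fun0 : F 0 = 0.
Proof.
have F_neg x : x < 0 -> F x = 0.
  move=> x0; rewrite dist_funE (_ : _ @^-1` _ = set0) ?pr_set0 //.
  apply/seteqP; split => // t /=; rewrite in_itv /= => h.
  by have := X_ge0 t; lra.
have h : F x @[x --> 0^'-] --> F 0 by apply: cvg_at_left_filter; exact: F_cont.
have h' : F x @[x --> 0^'-] --> (0 : R).
  apply: cvg_near_cst.
  by near=> x; apply: F_neg; near: x; exact: nbhs_left_lt.
exact: (cvg_unique _ h h').
Unshelve. all: by end_near. Qed.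

Lemma dist_fun_slope (e : R) : 0 < e ->
  exists2 x0, 0 < x0 & forall x, 0 <= x <= x0 -> `|F x - x| <= e * x.
Proof.
move=> e0; have /cvgrPdist_le/(_ e e0) := F_slope.
rewrite dist_fun0 => -[r /= r0 h].
exists (r / 2); first by rewrite divr_gt0.
move=> x /andP[x0 xr]; have [->|xn0] := eqVneq x 0; first by rewrite dist_fun0 subrr normr0 mulr0.
have xp : 0 < x by rewrite lt_neqAle eq_sym xn0.
have xr' : `|0 - x| < r by rewrite sub0r normrN gtr0_norm //; lra.
have := h x xr' xp; rewrite /= add0r subr0 => h'.
have -> : F x - x = - ((1 - F x / x) * x) by rewrite mulrBl mul1r mulfVK // opprB.
by rewrite normrN normrM (gtr0_norm xp) ler_pM2r.
Qed.

Section Copies.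
Context {d : measure_display} {T : measurableType d} {P : probability T R}.
Context {I : finType} {D : {set I}} {w : I -> {RV P >-> R}}.
Hypothesis w_iid : iid_copies_in X D w.

Lemma iid_pr e B : e \in D -> measurable B -> pr P (w e @^-1` B) = pr P0 (X @^-1` B).
Proof. by move=> eD mB; rewrite /pr; congr fine; apply: (w_iid.2 e eD B mB). Qed.

Lemma iid_pr_itv e a b : e \in D -> a <= b ->
  pr P (w e @^-1` `]a, b]) = F b - F a.
Proof.
move=> eD ab; rewrite iid_pr //.
rewrite !dist_funE (@pr_split _ _ _ _ (X @^-1` `]-oo, b]) (X @^-1` `]-oo, a])); last 2 first.
- exact: measurable_preimage_rv (fun _ : unit => X) tt _ _.
- exact: measurable_preimage_rv (fun _ : unit => X) tt _ _.
have -> : X @^-1` `]-oo, b] `&` X @^-1` `]-oo, a] = X @^-1` `]-oo, a].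
  apply/seteqP; split => [t []//|t /=]; rewrite !in_itv /= => h; split => //.
  exact: le_trans ab.
rewrite addrAC subrr add0r; congr pr; apply/seteqP; split => t /=.
  rewrite !in_itv /= => /andP[h1 h2]; split => //.
  by apply/negP; rewrite -ltNge.
by rewrite !in_itv /= => -[-> /negP]; rewrite -ltNge => ->.
Qed.

(** Only the law of [w e] is prescribed, so its positivity holds off this null event. Later proofs
    collect such events in a set [Z]. *)
Lemma iid_pr_le0 e : e \in D -> pr P (w e @^-1` `]-oo, 0]) = 0.
Proof. by move=> eD; rewrite iid_pr // -dist_funE dist_fun0. Qed.

End Copies.

(** The limit constant is the volume of a simplex. By induction on the number of weights, the value
    of one weight is cut into [L] bins of width [h = x / L], and the induction hypothesis handles
    the sum of the others. The factor [1 + th] or [1 - th] comes from the bins, that of [A] from the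
    induction hypothesis and that of [C] from the Riemann sum. The threshold [x0] must not depend on
    the family of weights, which is therefore quantified after it. *)
Lemma pr_sum_lt_asymp k (eps : R) : 0 < eps ->
  exists2 x0 : R, 0 < x0 &
  forall (d : measure_display) (T : measurableType d) (P : probability T R)
    (I : finType) (D J : {set I}) (w : I -> {RV P >-> R}),
  iid_copies_in X D w -> J \subset D -> #|J| = k ->
  forall x, 0 < x <= x0 ->
  `|pr P [set t | \sum_(e in J) w e t < x] - x ^+ k / k`!%:R| <= eps * x ^+ k.
Proof.
elim: k eps => [|k IH] eps eps0.
  exists 1 => // d T P I D J w _ _ /cards0_eq -> x /andP[x0 _].
  rewrite (_ : [set t | _] = setT) ?pr_setT; last first.
    by apply/seteqP; split => // t _ /=; rewrite big_set0.
  by rewrite fact0 expr0 divr1 subrr normr0 mulr1 ltW.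
pose A : R := k`!%:R^-1.
pose C : R := k.+1%:R^-1.
have A0 : 0 < A by rewrite invr_gt0 ltr0n fact_gt0.
have A1 : A <= 1 by rewrite invf_le1 ?ltr0n ?fact_gt0 // ler1n fact_gt0.
have C0 : 0 < C by rewrite invr_gt0 ltr0n.
have C1 : C <= 1 by rewrite invf_le1 ?ltr0n // ler1n.
(* The bound by [A] keeps [A - th] non-negative; the 7 is that of [triple_product_bounds]. *)
pose th := Num.min A (eps / 7).
have th0 : 0 < th by rewrite lt_min A0 divr_gt0.
have thA : th <= A by rewrite ge_min lexx.
have the' : th <= eps / 7 by rewrite ge_min lexx orbT.
have the : 7 * th <= eps by lra.
clearbody th.
have [L L0 Lth] : exists2 L : nat, (0 < L)%N & L%:R^-1 <= th.
  exists (Num.bound th^-1).+1 => //.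
  rewrite invf_ple ?posrE ?ltr0n //.
  by apply/ltW/(lt_le_trans (archi_boundP _)); rewrite ?invr_ge0 ?(ltW th0) // ler_nat.
have L0R : 0 < L%:R :> R by rewrite ltr0n.
have [x1 x1p H1] := IH th th0.
(* A bin has probability a difference of two values of [F] at points up to [x = L * h]. A relative
   slope error [th / (2 * L)] at both ends totals at most [th * h]. *)
have thL0 : 0 < th / (2 * L%:R) by rewrite divr_gt0 // mulr_gt0.
have [x2 x2p H2] := dist_fun_slope thL0.
exists (Num.min x1 x2); first by rewrite lt_min x1p.
move=> d T P I D J w iid JD Jk x /andP[x0]; rewrite le_min => /andP[xx1 xx2].
have [e eJ] : exists e, e \in J by apply/card_gt0P; rewrite Jk.
have eD : e \in D := fintype.subsetP JD e eJ.
pose J' := (J :\ e)%SET.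
have J'k : #|J'| = k by apply/eqP; rewrite -eqSS -Jk (cardsD1 e J) eJ.
have J'D : J' \subset D by apply: fintype.subset_trans JD; rewrite subD1set.
pose S t := \sum_(i in J') w i t.
have SE t : \sum_(i in J) w i t = w e t + S t by rewrite (big_setD1 e).
pose h := x / L%:R.
have h0 : 0 < h by rewrite divr_gt0.
have Lh : L%:R * h = x by rewrite mulrC divfK // gt_eqF.
pose bin i := w e @^-1` `]i%:R * h, i.+1%:R * h].
pose U y := S @^-1` `]-oo, y[.
have mbin i : measurable (bin i) by exact: measurable_preimage_rv.
have mU y : measurable (U y).
  by apply: (@sigma_rv_measurable _ _ _ P I w J'); exact: sigma_rv_sum.
have prbinU i y : pr P (bin i `&` U y) = pr P (bin i) * pr P (U y).
  apply: (@sigma_rv_independent _ _ _ P I w D [set e]%SET J') => //.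
  - exact: iid.1.
  - by rewrite finset.sub1set.
  - by rewrite disjoints1 !inE eqxx.
  - by apply: sigma_rv_rv => //; rewrite inE.
  - exact: sigma_rv_sum.
have prbin i : (i < L)%N -> `|pr P (bin i) - h| <= th * h.
  move=> iL; rewrite (iid_pr_itv iid) //; last by rewrite ler_pM2r // ler_nat.
  have b1 : 0 <= i.+1%:R * h <= x2.
    rewrite mulr_ge0 ?(ltW h0) //=; apply: le_trans xx2; rewrite -Lh ler_pM2r // ler_nat //.
  have b2 : 0 <= i%:R * h <= x2.
    rewrite mulr_ge0 ?(ltW h0) //=; apply: le_trans xx2; rewrite -Lh ler_pM2r // ler_nat ltnW //.
  have := H2 _ b1; have := H2 _ b2.
  set F1 := F (i%:R * h); set F2 := F (i.+1%:R * h) => G1 G2.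
  have -> : F2 - F1 - h = (F2 - i.+1%:R * h) - (F1 - i%:R * h).
    by rewrite -natr1; ring.
  apply: le_trans (ler_normB _ _) _.
  apply: le_trans (lerD G2 G1) _; rewrite -mulrDr.
  have : i.+1%:R * h + i%:R * h <= 2 * L%:R * h.
    rewrite -mulrDl ler_pM2r // -natrD -natrM ler_nat mul2n -addnn leq_add // ltnW //.
  move=> G; apply: (@le_trans _ _ (th / (2 * L%:R) * (2 * L%:R * h))).
    by rewrite ler_wpM2l // divr_ge0 ?(ltW th0) // mulr_ge0.
  by rewrite mulrA divfK // mulf_neq0 // gt_eqF.
(* The case [j = 0] is excluded because the induction hypothesis speaks of positive thresholds. *)
have prU j : (0 < j <= L)%N -> `|pr P (U (j%:R * h)) - (j%:R * h) ^+ k * A| <= th * (j%:R * h) ^+ k.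
  case/andP => j0 jL.
  have -> : U (j%:R * h) = [set t | \sum_(i in J') w i t < j%:R * h].
    by apply/seteqP; split => t; rewrite /U /= in_itv.
  apply: (H1 _ _ _ _ D) => //; rewrite mulr_gt0 ?ltr0n //=.
  by apply: le_trans xx1; rewrite -Lh ler_pM2r // ler_nat.
pose G := [set t | \sum_(i in J) w i t < x].
have GE : G = (fun t => \sum_(i in J) w i t) @^-1` `]-oo, x[.
  by apply/seteqP; split => t; rewrite /G /= in_itv.
have mG : measurable G.
  by rewrite GE; apply: (@sigma_rv_measurable _ _ _ P I w J); exact: sigma_rv_sum.
have xk : h ^+ k.+1 * L%:R ^+ k.+1 = x ^+ k.+1 by rewrite -exprMn mulrC Lh.
have xk0 : 0 < x ^+ k.+1 by rewrite exprn_gt0.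
pose s := \sum_(i < L) i.+1%:R ^+ k : R.
have sU : h ^+ k.+1 * s <= x ^+ k.+1 * (C + th).
  have /andP[_ B] := @sum_expr_bounds R k L.
  have B' : s <= L%:R ^+ k.+1 * (C + L%:R^-1).
    rewrite -(ler_pM2l (_ : 0 < k.+1%:R)) ?ltr0n //; apply: (le_trans B).
    rewrite mulrCA mulrDr divff ?pnatr_eq0 // mulrDr mulr1 lerD2l.
    by rewrite exprS [L%:R * _]mulrC -!mulrA [L%:R * _]mulrC -mulrA mulVf ?mulr1 ?gt_eqF // mulrC.
  apply: (le_trans (ler_wpM2l (exprn_ge0 _ (ltW h0)) B')).
  by rewrite mulrA xk ler_wpM2l ?(ltW xk0) // lerD2l.
have sL : x ^+ k.+1 * (C - th) <= h ^+ k.+1 * (s - L%:R ^+ k).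
  have /andP[B _] := @sum_expr_bounds R k L.
  have B' : L%:R ^+ k.+1 * (C - L%:R^-1) <= s - L%:R ^+ k.
    rewrite mulrBr [X in _ - X * _]exprSr mulfK ?gt_eqF // lerD2r.
    by rewrite ler_pdivrMr ?ltr0n // mulrC.
  apply: le_trans (ler_wpM2l (exprn_ge0 _ (ltW h0)) B').
  by rewrite mulrA xk ler_wpM2l ?(ltW xk0) // lerB.
have up : pr P G <= (1 + th) * (A + th) * (C + th) * x ^+ k.+1.
  (* Off [Z] all weights are positive. If [w e] lies in bin [i], then it exceeds [i * h], so the
     other weights sum to less than [(L - i) * h]. *)
  pose Z := \big[setU/set0]_(i in J) (w i @^-1` `]-oo, 0]).
  pose V := \big[setU/set0]_(i < L) (bin i `&` U ((L - i)%:R * h)).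
  have mZ : measurable Z by apply: bigsetU_measurable => i _; exact: measurable_preimage_rv.
  have mV : measurable V by apply: bigsetU_measurable => i _; exact: measurableI.
  have GV : G `<=` V `|` Z.
    move=> t Gt; have [Zt|nZ] := pselect (Z t); [by right|left].
    have wp i : i \in J -> 0 < w i t.
      move=> iJ; rewrite ltNge; apply/negP => wi; apply: nZ.
      by rewrite /Z -bigcup_seq_cond; exists i; rewrite /= ?mem_index_enum ?iJ // in_itv.
    have S0 : 0 <= S t by apply: sumr_ge0 => i; rewrite !inE => /andP[_ /wp/ltW].
    have wep := wp e eJ.
    move: Gt; rewrite /G /= SE => wSx.
    pose q := w e t / h.
    have q0 : 0 < q by rewrite divr_gt0.
    have qE : q * h = w e t by rewrite divfK // gt_eqF.
    (* Bins are open on the left, so [i] is one less than the least natural number that is at least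
       [q]. *)
    have [i [iq1 iq2]] : exists i : nat, i%:R < q /\ q <= i.+1%:R.
      have ex : exists n : nat, q <= n%:R.
        by exists (Num.bound q); apply/ltW/archi_boundP/ltW.
      case: (ex_minnP ex) => -[|n] qn nmin; first by move: q0; rewrite ltNge qn.
      exists n; split => //; rewrite ltNge; apply/negP => /nmin; by rewrite ltnn.
    have iL : (i < L)%N.
      rewrite -(ltr_nat R); apply: (lt_le_trans iq1).
      by rewrite ler_pdivrMr // Lh ltW // (le_lt_trans _ wSx) // lerDl.
    rewrite /V -bigcup_seq; exists (Ordinal iL); first by rewrite /= mem_index_enum.
    split; rewrite /bin /U /= in_itv /=.
      by rewrite -qE !(ltr_pM2r, ler_pM2r) // iq1.
    rewrite natrB ?(ltnW iL) // mulrBl Lh ltrBrDl.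
    apply: le_lt_trans wSx; rewrite lerD2r -qE ler_pM2r //; exact: ltW.
  have Z0 : pr P Z <= 0.
    apply: le_trans (pr_bigcup_le _ _ _ _) _; first by move=> i; exact: measurable_preimage_rv.
    rewrite big1 // => i iJ; rewrite (iid_pr_le0 iid) //; exact: (fintype.subsetP JD).
  have pV : pr P V <= \sum_(i < L) (h * (1 + th)) * (((L - i)%:R * h) ^+ k * (A + th)).
    apply: le_trans (pr_bigcup_le _ _ _ _) _; first by move=> i; exact: measurableI.
    apply: ler_sum => i _; rewrite prbinU; apply: ler_pM; rewrite ?pr_ge0 //.
      by have := prbin i (ltn_ord i); rewrite ler_norml => /andP[]; lra.
    have : (0 < L - i <= L)%N by rewrite subn_gt0 ltn_ord leq_subr.
    by move/prU; rewrite ler_norml => /andP[]; lra.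
  apply: (le_trans (le_pr _ _ _ GV)) => //; first exact: measurableU.
  apply: le_trans (pr_setU_le _ _ _) _ => //.
  apply: (@le_trans _ _ ((1 + th) * (A + th) * (h ^+ k.+1 * s))).
    apply: (le_trans (lerD pV Z0)); rewrite addr0 /s !mulr_sumr.
    rewrite [X in _ <= X](reindex_inj rev_ord_inj) /=; apply: ler_sum => i _.
    rewrite -subSn // subSS exprMn (exprS h); lra.
  have a0 : 0 <= (1 + th) * (A + th) by rewrite mulr_ge0 // addr_ge0 // ltW.
  have := ler_wpM2l a0 sU; lra.
have low : (1 - th) * (A - th) * (C - th) * x ^+ k.+1 <= pr P G.
  have sub i : (i < L)%N -> bin i `&` U ((L - i.+1)%:R * h) `<=` G.
    move=> iL t; rewrite /bin /U /= !in_itv /= => -[/andP[_ b2] u].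
    rewrite /G /= SE; move: u; rewrite natrB // mulrBl Lh; lra.
  have tr : trivIset [set` index_enum 'I_L] (fun i : 'I_L => bin i `&` U ((L - i.+1)%:R * h)).
    move=> i j _ _ [t [[bi _] [bj _]]]; apply/val_inj/eqP.
    have key (a b : nat) : bin a t -> bin b t -> (a <= b)%N.
      rewrite /bin /= !in_itv /= => /andP[a1 _] /andP[_ b1].
      by have := lt_le_trans a1 b1; rewrite ltr_pM2r // ltr_nat ltnS.
    by rewrite eqn_leq !key.
  have := @pr_disjoint_sum _ _ _ P _ (index_enum 'I_L) _ G (index_enum_uniq _)
    (fun i => measurableI _ _ (mbin i) (mU _)) mG tr (fun i _ => sub i (ltn_ord i)).
  apply: le_trans.
  have th1 : th <= 1 by lra.
  have b0 : 0 <= h * (1 - th) by rewrite mulr_ge0 ?subr_ge0 // ltW.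
  have -> : \sum_(i <- index_enum 'I_L) pr P (bin i `&` U ((L - i.+1)%:R * h)) =
     \sum_(i < L) pr P (bin i `&` U ((L - i.+1)%:R * h)) by [].
  (* The last bin is given up: it leaves the threshold 0 for the other weights. This removes the
     term [L ^ k] from the Riemann sum, as allowed for in [sL]. *)
  apply: (@le_trans _ _ (\sum_(i < L | (i.+1 < L)%N) (h * (1 - th)) * (((L - i.+1)%:R * h) ^+ k * (A - th)))).
    apply: (@le_trans _ _ ((1 - th) * (A - th) * (h ^+ k.+1 * (s - L%:R ^+ k)))).
      have a0 : 0 <= (1 - th) * (A - th) by rewrite mulr_ge0 ?subr_ge0.
      have := ler_wpM2l a0 sL; lra.
    have -> : s - L%:R ^+ k = \sum_(i < L | (i.+1 < L)%N) (L - i.+1)%:R ^+ k.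
      rewrite /s; case: (L) L0 => // L' _.
      rewrite big_ord_recr /= addrK [RHS]big_mkcond [RHS]big_ord_recr /= ltnn addr0.
      rewrite (reindex_inj rev_ord_inj) /=; apply: eq_bigr => i _.
      by rewrite ltnS ltn_ord subSS -subSn.
    rewrite !mulr_sumr; apply: ler_sum => i _; rewrite (exprS h) [(_ * h) ^+ k]exprMn; lra.
  rewrite [X in _ <= X](bigID (fun i : 'I_L => (i.+1 < L)%N)) /= ler_wpDr //.
    by apply: sumr_ge0 => i _; exact: pr_ge0.
  apply: ler_sum => i iL; rewrite prbinU.
  have p1 : h * (1 - th) <= pr P (bin i).
    by have := prbin i (ltn_ord i); rewrite ler_norml => /andP[]; lra.
  have p2 : ((L - i.+1)%:R * h) ^+ k * (A - th) <= pr P (U ((L - i.+1)%:R * h)).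
    have : (0 < L - i.+1 <= L)%N by rewrite subn_gt0 iL leq_subr.
    by move/prU; rewrite ler_norml => /andP[]; lra.
  apply: (le_trans (ler_wpM2l b0 p2)).
  by apply: ler_wpM2r => //; exact: pr_ge0.
have AC : x ^+ k.+1 / (k.+1)`!%:R = A * C * x ^+ k.+1.
  by rewrite factS natrM invfM mulrC [_^-1 * _]mulrC.
have [||||b1 b2] := @triple_product_bounds R th A C; rewrite ?(ltW th0) ?(ltW A0) ?(ltW C0) //.
  exact: le_trans thA A1.
have c1 := ler_wpM2r (ltW xk0) b1; have c2 := ler_wpM2r (ltW xk0) b2.
have c3 := ler_wpM2r (ltW xk0) the.
rewrite -/G AC ler_norml; apply/andP; split; lra.
Qed.

End SumAsymptotics.

(** * The limit law of the minimum weight *)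

Lemma exists_root (R : realType) (m : nat) (y : R) : (0 < m)%N -> 0 <= y ->
  exists2 r, 0 <= r & r ^+ m = y.
Proof.
move=> m0 y0; exists (y `^ m%:R^-1); first exact: powR_ge0.
by rewrite -powR_mulrn ?powR_ge0 // -powRrM mulVf ?pnatr_eq0 -?lt0n // powRr1.
Qed.

(** The estimate [s ^_ v >= s ^ v * (1 - v ^ 2 / s)], multiplied by [s] and rearranged to stay
    within [nat]. *)
Lemma expn_ffact_bound s v : (s ^ v.+1 <= s ^_ v * s + v ^ 2 * s ^ v)%N.
Proof.
elim: v => [|v IH]; first by rewrite expn1 ffactn0 mul1n leq_addr.
have le : (s ^_ v <= s ^ v)%N.
  rewrite ffact_prod -[v in (s ^ v)%N]card_ord -prod_nat_const.
  by apply: leq_prod => i _; apply: leq_subr.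
have h1 : (s ^_ v * s <= s ^_ v.+1 + v * s ^ v)%N.
  rewrite ffactnSr; apply: (@leq_trans (s ^_ v * (s - v) + v * s ^_ v)); last first.
    by rewrite leq_add2l leq_mul2l le orbT.
  by rewrite [(v * _)%N]mulnC -mulnDr leq_mul2l; apply/orP; right; rewrite addnC -leq_subLR.
have := leq_mul IH (leqnn s); have := leq_mul h1 (leqnn s).
by rewrite !expnS; move: (s ^_ v) (s ^_ v.+1) (s ^ v)%N => a b p; nia.
Qed.

Section Avoid.
Context {T : finType} (H : graph T).

Definition avoid {R : realType} {n} {Omega : Type} (w : {set 'I_n} -> Omega -> R) (U : {set 'I_n}) (x : R)
    : set Omega :=
  [set t | forall G, G \in copies_in H U -> x <= weight (fun e => w e t) G].

Definition light {R : realType} {n} {Omega : Type} (w : {set 'I_n} -> Omega -> R) (x : R)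
    (G : graph 'I_n) : set Omega :=
  [set t | weight (fun e => w e t) G < x].

Lemma avoidE (R : realType) n (d : measure_display) (Omega : measurableType d) (w : {set 'I_n} -> Omega -> R) U x :
  avoid w U x = none (light w x) (enum (copies_in H U)).
Proof.
apply/seteqP; split => t; rewrite noneP => h G.
  by rewrite mem_enum /light /= => /h; rewrite leNgt => /negP.
by move=> Gc; rewrite leNgt; apply/negP; apply: h; rewrite mem_enum.
Qed.

(** Here [rho] is [#|U| ^ (- 1 / m)]. For unions with [j] vertices, [rho ^ (m * j)] cancels the
    [#|U| ^ j] choices of the union, and the extra unit in the exponent leaves one factor [rho]. *)
Lemma sum_graph_pairs_le (R : realType) (V : finType) (U : {set V}) (m k : nat) (B rho : R)
    (Q : pred (graph V * graph V)) :
  0 <= B -> 0 <= rho -> rho ^+ m * #|U|%:R = 1 ->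
  (forall p, Q p -> vertices p.1 :|: vertices p.2 \subset U)%SET ->
  (forall p, Q p -> (#|vertices p.1 :|: vertices p.2|%SET <= k)%N) ->
  \sum_(p | Q p) B * rho ^+ (m * #|vertices p.1 :|: vertices p.2|%SET + 1) <=
  B * rho * (\sum_(j < k.+1) (2 ^ j * 2 ^ (2 ^ j)) ^ 2)%N%:R.
Proof.
move=> B0 r0 rU QU Qk.
rewrite (partition_big (fun p : graph V * graph V => inord #|vertices p.1 :|: vertices p.2|%SET : 'I_k.+1) xpredT) //=.
rewrite natr_sum mulr_sumr; apply: ler_sum => j _.
pose S := [set p : graph V * graph V | (vertices p.1 :|: vertices p.2 \subset U)
        && (#|vertices p.1 :|: vertices p.2| == j)]%SET.
apply: (@le_trans _ _ (\sum_(p in S) B * rho ^+ (m * j + 1))).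
  rewrite big_mkcond [X in _ <= X]big_mkcond; apply: ler_sum => p _.
  case: ifPn => [/andP[Qp /eqP E]|_]; last by case: ifP => // _; rewrite mulr_ge0 ?exprn_ge0.
  have Ej : #|vertices p.1 :|: vertices p.2|%SET = j.
    by rewrite -E inordK // ltnS Qk.
  by rewrite inE QU // Ej eqxx.
rewrite sumr_const -[X in X <= _]mulr_natl.
have := card_graph_pairs_on U j; rewrite -(ler_nat R) => h.
have Bj : 0 <= B * rho ^+ (m * j + 1) by rewrite mulr_ge0 ?exprn_ge0.
apply: (le_trans (ler_wpM2r Bj h)).
rewrite natrM [(#|U| ^ j)%:R]natrX exprD expr1 exprM.
have -> : forall q : R, q * #|U|%:R ^+ j * (B * (rho ^+ m ^+ j * rho)) = B * rho * q * (rho ^+ m * #|U|%:R) ^+ j.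
  by move=> q; rewrite exprMn; ring.
by rewrite rU expr1n mulr1.
Qed.

End Avoid.

(** * Light copies: independence, probabilities of pairs, and the sieve bound *)

Section UniformAsymptotics.
Context {R : realType} {d0 : measure_display} {Omega0 : measurableType d0}.
Context {P0 : probability Omega0 R} (X : {RV P0 >-> R}).
Hypothesis X_ge0 : forall t, 0 <= X t.
Hypothesis F_cont : continuous (dist_fun X).
Hypothesis F_slope : has_right_derivative (dist_fun X) 0 1.
Context {T : finType} (H : graph T).
Hypothesis balancedH : strictly_balanced H.
Hypothesis edgeH : (0 < nedges H)%N.

Local Notation m := (nedges H).
Local Notation v := (nverts H).
Local Notation a := (nauto H).

Section Weights.
Context {d : measure_display} {Omega : measurableType d} {P : probability Omega R}.
Context {n : nat} (w : {set 'I_n} -> {RV P >-> R}).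
Hypothesis w_iid : iid_copies_in X (edges (complete_graph n)) w.
Implicit Types (U : {set 'I_n}) (G : graph 'I_n) (x : R).

Lemma lightE x G : light w x G = (fun t => \sum_(e in edges G) w e t) @^-1` `]-oo, x[.
Proof. by apply/seteqP; split => t; rewrite /light /weight /= in_itv. Qed.

Lemma sigma_rv_light x G (J : {set {set 'I_n}}) :
  edges G \subset J -> sigma_rv w J (light w x G).
Proof. by move=> GJ; rewrite lightE; apply: sigma_rv_sum. Qed.

Lemma light_measurable x G : measurable (light w x G).
Proof. exact: sigma_rv_measurable (sigma_rv_light x (fintype.subxx _)). Qed.

Lemma sigma_rv_none x (s : seq (graph 'I_n)) (J : {set {set 'I_n}}) :
  (forall G, G \in s -> edges G \subset J) -> sigma_rv w J (none (light w x) s).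
Proof.
move=> sJ; rewrite /none big_seq; apply: sigma_rv_bigcap => G Gs.
by apply: sigma_rvC; apply: sigma_rv_light; exact: sJ.
Qed.

Lemma sigma_rv_avoid U x (J : {set {set 'I_n}}) :
  (forall e : {set 'I_n}, #|e| == 2%N -> e \subset U -> e \in J) -> sigma_rv w J (avoid H w U x).
Proof.
move=> UJ; rewrite avoidE; apply: sigma_rv_none => G; rewrite mem_enum inE => /andP[_ GU].
apply/fintype.subsetP => e eG; apply: UJ; first by rewrite (edge_card eG).
exact: fintype.subset_trans (edge_sub eG) GU.
Qed.

Lemma avoid_measurable U x : measurable (avoid H w U x).
Proof. by apply: (sigma_rv_measurable (J := [set: _]%SET)); apply: sigma_rv_avoid. Qed.

Lemma le_avoid U x y : x <= y -> pr P (avoid H w U y) <= pr P (avoid H w U x).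
Proof.
move=> xy; apply: le_pr; try exact: avoid_measurable.
by move=> t h G /h; apply: le_trans.
Qed.

(** Copies meeting both parts are ignored. The remaining two conditions involve pairs inside [U1]
    and pairs inside [U2], which are disjoint families of edges since an edge is non-empty. *)
Lemma avoid_halves U U1 U2 x : U1 \subset U -> U2 \subset U -> [disjoint U1 & U2]%B ->
  pr P (avoid H w U x) <= pr P (avoid H w U1 x) * pr P (avoid H w U2 x).
Proof.
move=> S1 S2 dU.
pose J (W : {set 'I_n}) := [set e : {set 'I_n} | (#|e| == 2) && (e \subset W)]%SET.
rewrite -(@sigma_rv_independent _ _ _ P _ w (edges (complete_graph n)) (J U1) (J U2)).
- apply: le_pr; [exact: avoid_measurable|apply: measurableI; exact: avoid_measurable|].
  move=> t h; split => G; rewrite inE => /andP[Gc GU]; apply: h;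
    by rewrite inE Gc (fintype.subset_trans GU).
- exact: w_iid.1.
- by apply/fintype.subsetP => e; rewrite !inE => /andP[].
- by apply/fintype.subsetP => e; rewrite !inE => /andP[].
- apply/pred0P => e /=; rewrite !inE; apply/negP => /andP[/andP[/eqP e2 e1] /andP[_ e3]].
  have [y ye] : exists y, y \in e by apply/card_gt0P; rewrite e2.
  by have := disjointFr dU (fintype.subsetP e1 _ ye); rewrite (fintype.subsetP e3).
- by apply: sigma_rv_avoid => e e2 eU; rewrite inE e2.
- by apply: sigma_rv_avoid => e e2 eU; rewrite inE e2.
Qed.

(* Up to the null event that some weight is not positive, both copies being light
   forces every edge of the union to have weight below [x]. *)
Lemma pr_light_pair x G1 G2 : 0 <= x ->
  pr P (light w x G1 `&` light w x G2) <= dist_fun X x ^+ #|edges G1 :|: edges G2|%SET.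
Proof.
move=> x0; set E := (edges G1 :|: edges G2)%SET.
have ED : E \subset edges (complete_graph n) by rewrite finset.subUset !copy_edges_sub.
pose A := \bigcap_(e in [set` E]) (w e @^-1` `]-oo, x]).
pose Z := \big[setU/set0]_(e in E) (w e @^-1` `]-oo, 0]).
have mA : measurable A.
  by apply: (cylinders_measurable (J := E) (w := w)); exists (fun=> `]-oo, x]%classic).
have mZ : measurable Z by apply: bigsetU_measurable => e _; exact: measurable_preimage_rv.
have sub : light w x G1 `&` light w x G2 `<=` A `|` Z.
  move=> t [t1 t2]; have [Zt|nZ] := pselect (Z t); [by right|left].
  have wp e : e \in E -> 0 < w e t.
    move=> eE; rewrite ltNge; apply/negP => we; apply: nZ.
    by rewrite /Z -bigcup_seq_cond; exists e; rewrite /= ?mem_index_enum ?eE // in_itv.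
  have key G e : light w x G t -> edges G \subset E -> e \in edges G -> w e t <= x.
    move=> + GE eG; rewrite /light /weight /= (big_setD1 e) //= => h.
    apply/ltW/(le_lt_trans _ h); rewrite lerDl; apply: sumr_ge0 => e'.
    by rewrite !inE => /andP[_ /(fintype.subsetP GE)/wp/ltW].
  move=> e /=; rewrite in_itv /= inE => /orP[] eG.
    by apply: (key G1) => //; rewrite finset.subsetUl.
  by apply: (key G2) => //; rewrite finset.subsetUr.
have mL : measurable (light w x G1 `&` light w x G2).
  by apply: measurableI; exact: light_measurable.
apply: (le_trans (le_pr _ mL _ sub)); first exact: measurableU.
apply: (le_trans (pr_setU_le _ mA mZ)).
have Z0 : pr P Z <= 0.
  apply: le_trans (pr_bigcup_le _ _ _ _) _; first by move=> e; exact: measurable_preimage_rv.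
  rewrite big1 // => e eE; rewrite (iid_pr_le0 X_ge0 F_cont w_iid) //.
  exact: (fintype.subsetP ED).
apply: (le_trans (lerD (lexx _) Z0)); rewrite addr0.
rewrite -prodr_const -lee_fin -prE // /A w_iid.1 // -prodEFin.
rewrite le_eqVlt; apply/orP; left; apply/eqP; apply: eq_bigr => e eE.
rewrite prE; last exact: measurable_preimage_rv.
by rewrite (iid_pr w_iid) // (fintype.subsetP ED).
Qed.

Definition overlap (G1 G2 : graph 'I_n) := (edges G1 :&: edges G2 != finset.set0)%SET.

(** Sharing an edge is the dependency relation of [sieve]: copies edge-disjoint from [G] are
    determined by the weights of the edges outside [G]. *)
Lemma avoid_sieve U x :
  `|pr P (avoid H w U x) - \prod_(G in copies_in H U) (1 - pr P (light w x G))| <=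
  \sum_(p | [&& p.1 \in copies_in H U, p.2 \in copies_in H U, p.2 != p.1 & overlap p.1 p.2])
     (pr P (light w x p.1) * pr P (light w x p.2) + pr P (light w x p.1 `&` light w x p.2)).
Proof.
have := @sieve R d Omega P (graph 'I_n) (light w x) overlap (light_measurable x)
  (enum (copies_in H U)) (enum_uniq _).
rewrite -avoidE big_enum /= => h.
apply: (le_trans (h _)).
  move=> G l Gl Gs ls al.
  pose J := (edges (complete_graph n) :\: edges G)%SET.
  apply: (@sigma_rv_independent _ _ _ P _ w (edges (complete_graph n)) (edges G) J).
  - exact: w_iid.1.
  - exact: copy_edges_sub.
  - by rewrite finset.subsetDl.
  - by apply/pred0P => e /=; rewrite !inE; case: (e \in edges G).
  - exact: sigma_rv_light.
  - apply: sigma_rv_none => G' G'l; rewrite finset.subsetD copy_edges_sub /=.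
    have /allP/(_ G' G'l) := al; rewrite /overlap negbK finset.setIC => /eqP E.
    by rewrite -finset.setI_eq0 E eqxx.
rewrite big_enum /=.
under eq_bigr do rewrite big_enum_cond /=.
by rewrite pair_big_dep.
Qed.

End Weights.
End UniformAsymptotics.

Lemma mem_copies_in (T : finType) (H : graph T) n (U : {set 'I_n}) G :
  (G \in copies_in H U) = (G \in copies H n) && (vertices G \subset U).
Proof. by rewrite inE. Qed.

Lemma sum_sqr_bound (R : realFieldType) (N y M s : R) :
  N * y * y <= M * (M / s) -> N * (2 * y) ^+ 2 <= 4 * M ^+ 2 / s.
Proof. by rewrite exprMn !expr2; lra. Qed.

Lemma count_minus_main (R : fieldType) (N y f a s : R) : f != 0 -> a != 0 ->
  N * (y / f) - y * s / (f * a) = y / (f * a) * (N * a - s).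
Proof. by move=> f0 a0; field; rewrite f0 a0. Qed.

Lemma small_quotient (R : realFieldType) (c eps s : R) :
  0 < eps -> 0 < s -> 4 * c / eps <= s -> c / s <= eps / 4.
Proof. by move=> e0 s0; rewrite ler_pdivrMr // ler_pdivrMr // => ?; lra. Qed.

Lemma mul_small (R : realFieldType) (B eps r : R) :
  0 <= B -> 0 < eps -> r <= eps / (4 * (B + 1)) -> B * r <= eps / 4.
Proof.
move=> B0 e0 h; apply: (le_trans (ler_wpM2l B0 h)).
rewrite mulrA ler_pdivrMr; last by lra.
have := mulr_ge0 B0 (ltW e0); lra.
Qed.

Lemma dist_trans4 (R : realFieldType) (p q r t e : R) :
  `|p - q| <= e / 4 -> `|q - r| <= e / 4 -> `|r - t| <= e / 4 + e / 4 -> `|p - t| <= e.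
Proof.
move=> h1 h2 h3; have := ler_distD q p t; have := ler_distD r q t; lra.
Qed.

Lemma bound_le (R : archiRealFieldType) (y : R) (k : nat) :
  0 <= y -> (Num.bound y <= k)%N -> y <= k%:R.
Proof.
move=> y0 yk; apply: le_trans (_ : (Num.bound y)%:R <= _); last by rewrite ler_nat.
exact/ltW/archi_boundP.
Qed.

Lemma dist_le2 (R : realFieldType) (F x : R) : `|F - x| <= 1 * x -> F <= 2 * x.
Proof. by rewrite ler_norml => /andP[_]; lra. Qed.

Lemma expR_small (R : realType) (e : R) : 0 < e -> expR (- (2 / e)) <= e / 2.
Proof.
move=> e0; have t0 : 0 < 2 / e by rewrite divr_gt0.
rewrite expRN invf_ple ?posrE ?expR_gt0 ?divr_gt0 // invf_div.
by apply: le_trans (expR_ge1Dx _); rewrite lerDr.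
Qed.

Lemma dist_in_unit (R : realDomainType) (p q e : R) :
  0 <= p <= e -> 0 <= q <= e -> `|p - q| <= e.
Proof. by move=> /andP[? ?] /andP[? ?]; rewrite ler_norml; apply/andP; split; lra. Qed.

(** Serves the level 0: [q] is the probability at a small positive level, whose limit
    [exp (- e / 2)] is at least [1 - e / 2]. *)
Lemma near_one (R : realType) (p q e : R) : p <= 1 -> q <= p ->
  `|q - expR (- (e / 2))| <= e / 2 -> `|p - 1| <= e.
Proof.
move=> p1 qp; have := expR_ge1Dx (- (e / 2)); rewrite !ler_norml => h /andP[h1 h2].
by apply/andP; split; lra.
Qed.

(** Serves large levels: [p] is dominated by the probability [q] at a smaller level where the limit
    is already at most [e / 2], so [p] and [exp (- y)] both lie in [[0, e]]. *)
Lemma near_zero (R : realType) (p q y e : R) : 0 < e -> 0 <= p -> p <= q -> 2 / e <= y ->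
  `|q - expR (- (2 / e))| <= e / 2 -> `|p - expR (- y)| <= e.
Proof.
move=> e0 p0 pq ey; have := expR_small e0; have := expR_ge0 (- y).
have : expR (- y) <= expR (- (2 / e)) by rewrite ler_expR lerN2.
rewrite ler_norml => h1 h2 h3 /andP[h4 h5].
by apply: dist_in_unit; apply/andP; split; lra.
Qed.

Section LimitLaw.
Context {R : realType} {d0 : measure_display} {Omega0 : measurableType d0}.
Context {P0 : probability Omega0 R} (X : {RV P0 >-> R}).
Hypothesis X_ge0 : forall t, 0 <= X t.
Hypothesis F_cont : continuous (dist_fun X).
Hypothesis F_slope : has_right_derivative (dist_fun X) 0 1.
Context {T : finType} (H : graph T).
Hypothesis balancedH : strictly_balanced H.
Hypothesis edgeH : (0 < nedges H)%N.

Local Notation m := (nedges H).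
Local Notation v := (nverts H).
Local Notation a := (nauto H).

Lemma v_gt0 : (0 < v)%N. Proof. exact: ltnW (nedges_nverts edgeH). Qed.

Section Weights.
Context {d : measure_display} {Omega : measurableType d} {P : probability Omega R}.
Context {n : nat} (w : {set 'I_n} -> {RV P >-> R}).
Hypothesis w_iid : iid_copies_in X (edges (complete_graph n)) w.
Implicit Types (U : {set 'I_n}) (G : graph 'I_n) (x : R).

(** With [rho = #|U| ^ (- 1 / m)], the bound on [dist_fun X x] says that [x] has the critical order
    [#|U| ^ (- v / m)]. A pair whose union has [j] vertices and [e] edges then costs a constant
    times [rho ^ (v * e)], and [v * e >= m * j + 1] by [union_denser]. The leading 2 accounts for
    the product term and the joint term. *)
Lemma overlap_sum_le U x (K rho : R) :
  0 < rho <= 1 -> rho ^+ m * #|U|%:R = 1 -> 0 <= x -> 1 <= K ->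
  dist_fun X x <= 2 * K * rho ^+ v ->
  \sum_(p | [&& p.1 \in copies_in H U, p.2 \in copies_in H U, p.2 != p.1 & overlap p.1 p.2])
     (pr P (light w x p.1) * pr P (light w x p.2) + pr P (light w x p.1 `&` light w x p.2))
  <= 2 * (2 * K) ^+ (2 * m) * rho *
     (\sum_(j < (2 * v).+1) (2 ^ j * 2 ^ (2 ^ j)) ^ 2)%N%:R.
Proof.
move=> /andP[r0 r1] rU x0 K1 FK.
have F0 : 0 <= dist_fun X x by exact: pr_ge0.
have F1 : dist_fun X x <= 1 by rewrite dist_funE pr_le1 //; exact: (measurable_preimage_rv (fun=> X) tt).
have K2 : 1 <= 2 * K by apply: (le_trans K1); rewrite ler_peMl ?(le_trans ler01 K1) // ler1n.
have K20 : 0 <= 2 * K := le_trans ler01 K2.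
have B0 : 0 <= 2 * (2 * K) ^+ (2 * m) by rewrite mulr_ge0 // exprn_ge0.
pose Q (p : graph 'I_n * graph 'I_n) :=
  [&& p.1 \in copies_in H U, p.2 \in copies_in H U, p.2 != p.1 & overlap p.1 p.2].
have QU p : Q p -> (vertices p.1 :|: vertices p.2 \subset U)%SET.
  by case/and4P; rewrite !mem_copies_in => /andP[_ h1] /andP[_ h2] _ _; rewrite finset.subUset h1.
have Qk p : Q p -> (#|vertices p.1 :|: vertices p.2|%SET <= 2 * v)%N.
  case/and4P; rewrite !mem_copies_in => /andP[c1 _] /andP[c2 _] _ _.
  by rewrite cardsU (copy_nverts c1) (copy_nverts c2) mul2n -addnn leq_subr.
apply: le_trans (sum_graph_pairs_le B0 (ltW r0) rU QU Qk).
apply: ler_sum => -[G1 G2] /= /and4P[]; rewrite !mem_copies_in => /andP[c1 _] /andP[c2 _] ne ov.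
rewrite eq_sym in ne.
have den := union_denser balancedH c1 c2 ne ov.
set j := #|vertices G1 :|: vertices G2|%SET in den *.
have e2m : (#|edges G1 :|: edges G2|%SET <= 2 * m)%N.
  by rewrite cardsU (copy_nedges c1) (copy_nedges c2) mul2n -addnn leq_subr.
set e := #|edges G1 :|: edges G2|%SET in den e2m *.
have Fe : dist_fun X x ^+ e <= (2 * K) ^+ (2 * m) * rho ^+ (m * j + 1).
  apply: (@le_trans _ _ ((2 * K * rho ^+ v) ^+ e)).
    by rewrite lerXn2r ?nnegrE // mulr_ge0 ?exprn_ge0 ?(ltW r0).
  rewrite exprMn -exprM ler_pM ?exprn_ge0 ?(ltW r0) //.
    exact: ler_weXn2l.
  by apply: ler_wiXn2l; rewrite ?(ltW r0) // addn1.
have single G : G \in copies H n -> pr P (light w x G) <= dist_fun X x ^+ m.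
  move=> c; have := pr_light_pair X_ge0 F_cont w_iid G G x0.
  by rewrite setIid finset.setUid (copy_nedges c).
(* The product carries [2 * m] factors of [F], at least as many as the union has edges, and [F] is
   at most 1. *)
have p12 : pr P (light w x G1) * pr P (light w x G2) <= dist_fun X x ^+ e.
  apply: (@le_trans _ _ (dist_fun X x ^+ m * dist_fun X x ^+ m)).
    by rewrite ler_pM ?pr_ge0 ?single.
  by rewrite -exprD addnn -mul2n; apply: ler_wiXn2l.
have := pr_light_pair X_ge0 F_cont w_iid G1 G2 x0; rewrite -/e => p3.
by apply: (le_trans (lerD p12 p3)); apply: (le_trans (lerD Fe Fe)); rewrite -mulrA; set y := (_ * _ ^+ (_ + 1)); rewrite mulr_natl mulr2n.
Qed.

(** The error [eta * M] comes from the probability of a single copy, and the term with [v ^ 2] from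
    replacing the falling factorial in the number of copies by a power. For the squares,
    [x ^ m <= M / #|U|] because [v] is at least 1. *)
Lemma sum_light_asymp U x (eta M : R) :
  (0 < n)%N -> (0 < #|U|)%N -> 0 < x -> 0 <= eta <= 1 -> x ^+ m * #|U|%:R ^+ v <= M ->
  (forall G, G \in copies_in H U -> `|pr P (light w x G) - x ^+ m / m`!%:R| <= eta * x ^+ m) ->
  `|\sum_(G in copies_in H U) pr P (light w x G) - x ^+ m * #|U|%:R ^+ v / (m`! * a)%:R|
     <= eta * M + (v ^ 2)%:R * M / #|U|%:R /\
  \sum_(G in copies_in H U) pr P (light w x G) ^+ 2 <= 4 * M ^+ 2 / #|U|%:R.
Proof.
move=> n0 s0 x0 /andP[eta0 eta1]; set s : R := #|U|%:R => xM hp.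
have sp : 0 < s by rewrite ltr0n.
have s1 : 1 <= s by rewrite ler1n.
have xm : 0 < x ^+ m by rewrite exprn_gt0.
have sv : s <= s ^+ v by rewrite -[X in X <= _]expr1 ler_weXn2l // v_gt0.
set C := copies_in H U in hp *.
have Na : (#|C| * a)%N = #|U| ^_ v by exact: card_copies_in.
have a0 : (0 < a)%N := nauto_gt0 H.
have f0 : (0 < m`!)%N := fact_gt0 m.
have ff : (#|U| ^_ v <= #|U| ^ v)%N.
  rewrite ffact_prod -[v in (_ ^ v)%N]card_ord -prod_nat_const.
  by apply: leq_prod => i _; apply: leq_subr.
have Ns : #|C|%:R <= s ^+ v.
  rewrite -natrX ler_nat; apply: leq_trans ff; rewrite -Na leq_pmulr //.
have NxM : #|C|%:R * x ^+ m <= M.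
  by apply: le_trans xM; rewrite mulrC ler_wpM2l // ltW.
split.
  set A : R := #|C|%:R * (x ^+ m / m`!%:R).
  rewrite -(subrK A (\sum_(G in C) _)) -addrA.
  apply: le_trans (ler_normD _ _) _; apply: lerD.
    rewrite /A mulr_natl -sumr_const -sumrB.
    apply: le_trans (ler_norm_sum _ _ _) _.
    apply: (@le_trans _ _ (\sum_(G in C) eta * x ^+ m)); first exact: ler_sum.
    rewrite sumr_const -[X in X <= _]mulr_natl mulrCA ler_wpM2l //.
  have fa0 : 0 < (m`! * a)%:R :> R by rewrite ltr0n muln_gt0 f0.
  have -> : A - x ^+ m * s ^+ v / (m`! * a)%:R =
      x ^+ m / (m`! * a)%:R * ((#|U| ^_ v)%:R - s ^+ v).
    by rewrite -Na /A !natrM count_minus_main // pnatr_eq0 -lt0n.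
  rewrite normrM distrC !ger0_norm ?subr_ge0 -?natrX ?ler_nat //; last first.
    by rewrite divr_ge0 // ltW.
  rewrite natrX -/s.
  have gap : s ^+ v - (#|U| ^_ v)%:R <= (v ^ 2)%:R * s ^+ v / s.
    rewrite ler_pdivlMr // mulrBl lerBlDl.
    by have := expn_ffact_bound #|U| v; rewrite -(ler_nat R) natrD !natrM !natrX exprSr.
  have x1 : x ^+ m / (m`! * a)%:R <= x ^+ m.
    by rewrite ler_pdivrMr // ler_peMr ?(ltW xm) // ler1n muln_gt0 f0.
  have g0 : 0 <= s ^+ v - (#|U| ^_ v)%:R by rewrite subr_ge0 -natrX ler_nat.
  apply: (le_trans (ler_wpM2r g0 x1)).
  apply: (le_trans (ler_wpM2l (ltW xm) gap)).
  rewrite mulrA ler_pM2r ?invr_gt0 // mulrCA ler_wpM2l //.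
have p2 G : G \in C -> pr P (light w x G) ^+ 2 <= (2 * x ^+ m) ^+ 2.
  move=> /hp; rewrite ler_norml => /andP[_ h].
  have f1 : x ^+ m / m`!%:R <= x ^+ m by rewrite ler_pdivrMr ?ltr0n // ler_peMr ?(ltW xm) // ler1n.
  have h2 := ler_wpM2r (ltW xm) eta1.
  rewrite mul1r in h2.
  rewrite lerXn2r ?nnegrE ?pr_ge0 ?mulr_ge0 ?(ltW xm) //.
  by rewrite -(subrK (x ^+ m / m`!%:R) (pr _ _)) mulr_natl mulr2n lerD // (le_trans h).
apply: (@le_trans _ _ (\sum_(G in C) (2 * x ^+ m) ^+ 2)); first exact: ler_sum.
rewrite sumr_const -[X in X <= _]mulr_natl.
have M0 : 0 <= M by apply: le_trans xM; rewrite mulr_ge0 ?exprn_ge0 // ltW.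
have xs : x ^+ m <= M / s.
  rewrite ler_pdivlMr //; apply: le_trans xM; rewrite ler_wpM2l // ltW //.
have := ler_pM (mulr_ge0 (ler0n R #|C|) (ltW xm)) (ltW xm) NxM xs.
exact: sum_sqr_bound.
Qed.

End Weights.

Lemma avoid_asymp_bounded (M eps : R) : 0 < M -> 0 < eps ->
  exists s0 : nat, forall (d : measure_display) (Omega : measurableType d)
    (P : probability Omega R) (n : nat) (w : {set 'I_n} -> {RV P >-> R}) (U : {set 'I_n}),
  iid_copies_in X (edges (complete_graph n)) w -> (s0 <= #|U|)%N ->
  forall x, 0 < x -> x ^+ m * #|U|%:R ^+ v <= M ->
  `|pr P (avoid H w U x) - expR (- (x ^+ m * #|U|%:R ^+ v / (m`! * a)%:R))| <= eps.
Proof.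
move=> M0 eps0.
pose eta := Num.min 1 (eps / (4 * M)).
have eta0 : 0 < eta by rewrite lt_min ltr01 divr_gt0 // mulr_gt0.
have eta1 : eta <= 1 by rewrite ge_min lexx.
have etaM : eta * M <= eps / 4.
  have : eta <= eps / (4 * M) by rewrite ge_min lexx orbT.
  by rewrite ler_pdivlMr ?mulr_gt0 // [4 * M]mulrC mulrA => ?; rewrite ler_pdivlMr.
clearbody eta.
have [x0 x0p H0] := pr_sum_lt_asymp X_ge0 F_cont F_slope m eta0.
have [x1 x1p H1] := dist_fun_slope X_ge0 F_cont F_slope (ltr01 : 0 < (1 : R)).
pose xm := Num.min x0 x1.
have xmp : 0 < xm by rewrite lt_min x0p.
(* Being at least 1 and at least [M], it satisfies [K ^ m >= M], which turns the bound on [x ^ m]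
   into [x <= K * rho ^ v]. *)
pose K := 1 + M.
have K1 : 1 <= K by rewrite lerDl ltW.
pose B : R := 2 * (2 * K) ^+ (2 * m) * (\sum_(j < (2 * v).+1) (2 ^ j * 2 ^ (2 ^ j)) ^ 2)%N%:R.
have B0 : 0 <= B by rewrite !mulr_ge0 // exprn_ge0 // mulr_ge0 // (le_trans ler01).
pose del := eps / (4 * (B + 1)).
have delp : 0 < del by rewrite divr_gt0 // mulr_gt0 // ltr_wpDl.
(* Size [S1] puts [x] in the range of the estimates near zero, [S2] makes [rho] at most [del] for
   the overlap term, [S3] controls the falling factorial, and [S4] the sum of squared
   probabilities. *)
pose S1 := M / xm ^+ m.
pose S2 := (del ^+ m)^-1.
pose S3 := 4 * ((v ^ 2)%:R * M) / eps.
pose S4 := 4 * (4 * M ^+ 2) / eps.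
have S1p : 0 <= S1 by rewrite divr_ge0 ?exprn_ge0 // ltW.
have S2p : 0 <= S2 by rewrite invr_ge0 exprn_ge0 // ltW.
have S3p : 0 <= S3 by rewrite divr_ge0 ?mulr_ge0 // ltW.
have S4p : 0 <= S4 by rewrite divr_ge0 ?mulr_ge0 ?exprn_ge0 // ltW.
exists (maxn 1 (maxn (maxn (Num.bound S1) (Num.bound S2)) (maxn (Num.bound S3) (Num.bound S4)))).
move=> d Omega P n w U iid; rewrite !geq_max -!andbA.
case/and5P => U0 /(bound_le S1p) sS1 /(bound_le S2p) sS2 /(bound_le S3p) sS3 /(bound_le S4p) sS4.
move=> x xp; move: sS1 sS2 sS3 sS4; set s : R := #|U|%:R => sS1 sS2 sS3 sS4 xM.
have s1 : 1 <= s by rewrite ler1n.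
have sp : 0 < s := lt_le_trans ltr01 s1.
have n0 : (0 < n)%N by apply: leq_trans U0 _; rewrite -[n in (_ <= n)%N]card_ord max_card.
have sv : s <= s ^+ v by rewrite -[X in X <= _]expr1 ler_weXn2l // v_gt0.
have xmE : 0 < x ^+ m by rewrite exprn_gt0.
have xs : x ^+ m * s <= M by apply: le_trans xM; rewrite ler_wpM2l // ltW.
have xle : x <= xm.
  rewrite -(ler_pXn2r edgeH) ?nnegrE ?(ltW xp) ?(ltW xmp) //.
  move: sS1; rewrite /S1 ler_pdivrMr ?exprn_gt0 // [s * _]mulrC => h.
  by rewrite -(ler_pM2r sp); exact: le_trans h.
have /andP[xx0 xx1] : (x <= x0) && (x <= x1) by rewrite -le_min.
have hp G : G \in copies_in H U -> `|pr P (light w x G) - x ^+ m / m`!%:R| <= eta * x ^+ m.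
  rewrite inE => /andP[c _].
  have := H0 d Omega P _ _ (edges G) w iid (copy_edges_sub G) (copy_nedges c) x.
  by rewrite xp xx0 => /(_ isT).
have eta01 : 0 <= eta <= 1 by rewrite (ltW eta0).
have [l1 l2] := sum_light_asymp n0 U0 xp eta01 xM hp.
have si0 : 0 <= s^-1 by rewrite invr_ge0 ltW.
have [rho rho0 rhoE] := exists_root edgeH si0.
have rhop : 0 < rho.
  rewrite lt_neqAle rho0 andbT; apply/eqP => r0.
  by move: rhoE; rewrite -r0 expr0n eqn0Ngt edgeH /= => /esym/eqP; rewrite invr_eq0 gt_eqF.
have rho1 : rho <= 1 by rewrite -(expr_le1 edgeH) // rhoE invf_le1.
have rhod : rho <= del.
  rewrite -(ler_pXn2r edgeH) ?nnegrE ?(ltW delp) // rhoE.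
  by rewrite invf_ple ?posrE ?exprn_gt0.
have rhos : rho ^+ m * s = 1 by rewrite rhoE mulVf // gt_eqF.
have xK : x <= K * rho ^+ v.
  rewrite -(ler_pXn2r edgeH) ?nnegrE ?(ltW xp) ?mulr_ge0 ?exprn_ge0 ?(le_trans ler01 K1) //.
  rewrite exprMn -exprM mulnC exprM rhoE exprVn ler_pdivlMr ?exprn_gt0 //.
  apply: (le_trans xM); apply: (@le_trans _ _ K); first by rewrite lerDr.
  by rewrite -[X in X <= _]expr1 ler_weXn2l.
have FK : dist_fun X x <= 2 * K * rho ^+ v.
  have xx : 0 <= x <= x1 by rewrite (ltW xp).
  by apply: (le_trans (dist_le2 (H1 x xx))); rewrite -mulrA ler_pM2l.
have rho01 : 0 < rho <= 1 by rewrite rhop.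
have ov := overlap_sum_le iid rho01 rhos (ltW xp) K1 FK.
have p01 (G : graph 'I_n) : 0 <= pr P (light w x G) <= 1.
  by rewrite pr_ge0 pr_le1 //; exact: light_measurable.
have pe := prod_onem_expR (enum (copies_in H U)) p01.
rewrite !big_enum /= in pe.
(* The route is from the probability to the product of [1 - p], then to the exponential of minus the
   mean, then to the limit. The last stage spends two quarters of [eps]. *)
apply: dist_trans4.
- apply: (le_trans (avoid_sieve H iid U x)); apply: (le_trans ov).
  by rewrite mulrAC -/B; exact: mul_small.
- apply: (le_trans pe); apply: (le_trans l2); exact: small_quotient.
- apply: (le_trans (expR_lipschitz _ _)).
  + by apply: sumr_ge0 => G _; exact: pr_ge0.
  + by rewrite divr_ge0 ?mulr_ge0 ?exprn_ge0 // ltW.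
  apply: (le_trans l1); apply: lerD => //; exact: small_quotient.
Qed.

(** Monotonicity in [x] removes the restriction to bounded levels: [x = 0] is compared with the
    level [M1], where the limit is [exp (- eps / 2)], and large [x] with the level [M], where it is
    [exp (- 2 / eps)]. *)
Lemma avoid_asymp (eps : R) : 0 < eps ->
  exists s0 : nat, forall (d : measure_display) (Omega : measurableType d)
    (P : probability Omega R) (n : nat) (w : {set 'I_n} -> {RV P >-> R}) (U : {set 'I_n}),
  iid_copies_in X (edges (complete_graph n)) w -> (s0 <= #|U|)%N ->
  forall x, 0 <= x ->
  `|pr P (avoid H w U x) - expR (- (x ^+ m * #|U|%:R ^+ v / (m`! * a)%:R))| <= eps.
Proof.
move=> eps0; pose c : R := (m`! * a)%:R.
have c0 : 0 < c by rewrite ltr0n muln_gt0 fact_gt0 nauto_gt0.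
have e20 : 0 < eps / 2 by rewrite divr_gt0.
pose M := c * (2 / eps).
have M0 : 0 < M by rewrite mulr_gt0 ?divr_gt0.
pose M1 := c * (eps / 2).
have M10 : 0 < M1 by rewrite mulr_gt0 ?divr_gt0.
have MM0 : 0 < Num.max M M1 by rewrite lt_max M0.
have [s0 h0] := avoid_asymp_bounded MM0 e20.
exists (maxn 1 s0) => d Omega P n w U iid; rewrite geq_max => /andP[U0 sU] x x0.
have {}h0 := h0 d Omega P n w U iid sU.
set s : R := #|U|%:R in h0 *; rewrite -/c in h0 *.
have s1 : 1 <= s by rewrite ler1n.
have sp : 0 < s ^+ v by rewrite exprn_gt0 // (lt_le_trans ltr01).
have at_level y : 0 < y -> y <= Num.max M M1 -> exists x', [/\ 0 < x', x' ^+ m * s ^+ v = y &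
    `|pr P (avoid H w U x') - expR (- (y / c))| <= eps / 2].
  move=> y0 yM; have ys : 0 <= y / s ^+ v by rewrite divr_ge0 // ltW.
  have [x' x'0 x'E] := exists_root edgeH ys.
  have x'p : 0 < x'.
    rewrite lt_neqAle x'0 andbT; apply/eqP => r0; move: x'E.
    rewrite -r0 expr0n eqn0Ngt edgeH /= => /esym/eqP.
    by rewrite mulf_eq0 invr_eq0 !gt_eqF.
  have yE : x' ^+ m * s ^+ v = y by rewrite x'E divfK // gt_eqF.
  by exists x'; split => //; rewrite -yE; apply: h0 => //; rewrite yE.
have [xM|Mx] := leP (x ^+ m * s ^+ v) (Num.max M M1).
  have [x00|xn0] := eqVneq x 0.
    have [|x' [x'0 _ h']] := at_level _ M10; first by rewrite le_max lexx orbT.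
    rewrite x00 expr0n eqn0Ngt edgeH mul0r mul0r oppr0 expR0.
    apply: (near_one _ (le_avoid _ _ _ (ltW x'0))); first exact/pr_le1/avoid_measurable.
    by move: h'; rewrite /M1 [c * _]mulrC mulfK // gt_eqF.
  by apply: (le_trans (h0 _ _ xM)); [rewrite lt_neqAle eq_sym xn0|rewrite ler_pdivrMr // ler_peMr ?(ltW eps0) // ler1n].
have [|x' [x'0 x'E h']] := at_level _ M0; first by rewrite le_max lexx.
have {}Mx : M < x ^+ m * s ^+ v by apply: le_lt_trans Mx; rewrite le_max lexx.
have x'x : x' <= x.
  rewrite -(ler_pXn2r edgeH) ?nnegrE ?(ltW x'0) // -(ler_pM2r sp) x'E; exact: ltW.
apply: (near_zero eps0 (pr_ge0 _ _) (le_avoid _ _ _ x'x)).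
  by rewrite ler_pdivlMr // mulrC; exact: ltW.
by move: h'; rewrite /M [c * _]mulrC mulfK // gt_eqF.
Qed.

End LimitLaw.

(** * Convergence of the expectation *)

Lemma bigcup_itvcc_gt0 (R : realType) (u v : nat -> R) :
  (forall k, 0 < u k) -> (forall x, 0 < x -> exists k, u k <= x <= v k) ->
  \bigcup_k `[u k, v k]%classic = `]0, +oo[%classic.
Proof.
move=> u0 uv; apply/seteqP; split => [x [k _]|x] /=; rewrite !in_itv /= ?andbT.
  by case/andP => h _; exact: lt_le_trans h.
by move=> /uv[k h]; exists k => //=; rewrite in_itv.
Qed.

Lemma itvcc_nondecreasing (R : realType) (u v : nat -> R) :
  {homo u : i j / (i <= j)%N >-> j <= i} -> {homo v : i j / (i <= j)%N >-> i <= j} ->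
  nondecreasing_seq (fun k => `[u k, v k]%classic).
Proof.
move=> hu hv i j ij; apply/subsetPset => x /=; rewrite !in_itv /= => /andP[h1 h2].
by rewrite (le_trans (hu _ _ ij) h1) (le_trans h2 (hv _ _ ij)).
Qed.

(** * The integral of [exp (- q * x ^ m)] in terms of [Gamma] *)

Section StretchedExponential.
Context {R : realType}.
Variables (k : nat) (q : R).
Hypothesis q0 : 0 < q.
Local Notation mu := (@lebesgue_measure R).
Local Notation m := k.+1.
Local Notation p := (k.+1%:R^-1 : R).
Let F x : R := q * x ^+ m.
Let G x : R := x `^ (p - 1) * expR (- x).
Let E x : R := expR (- (x ^+ m * q)).

Let derive_F (x : R) : is_derive x (1 : R) F (q * (m%:R * x ^+ k)).
Proof.
have -> : F = q \*: (@id R ^+ m) by apply/funext => y; rewrite /F fctE.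
by apply: is_derive_eq; rewrite /GRing.scale /= mulr1.
Qed.

Let F1 : F^`()%classic = fun x => q * (m%:R * x ^+ k).
Proof. by apply/funext => x; rewrite derive1E; have [_ ->] := derive_F x. Qed.

Let F1_cont : continuous (F^`()%classic).
Proof.
rewrite F1 => x; apply: cvgM; first exact: cvg_cst.
by apply: cvgM; [exact: cvg_cst|exact: exprn_continuous].
Qed.

(** The substitution [y = q * x ^ m] turns the integrand of [Gamma (1 / m)] into a constant times
    the stretched exponential, since [p = 1 / m] gives [y ^ p = q ^ p * x]. *)
Let GF x : 0 < x -> G (F x) * (F^`()%classic x) = m%:R * q `^ p * E x.
Proof.
move=> x0; rewrite F1 /G /E /F [x ^+ m * q]mulrC.
set e := expR _; set y := q * x ^+ m.
have xm : 0 < x ^+ m by rewrite exprn_gt0.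
have y0 : 0 < y by rewrite mulr_gt0.
have xk : 0 < x ^+ k by rewrite exprn_gt0.
have h : y * y `^ (p - 1) = q `^ p * x.
  rewrite mulr_powRB1 ?(ltW y0) ?invr_gt0 ?ltr0n // /y powRM ?(ltW q0) ?(ltW xm) //; congr (_ * _).
  by rewrite -powR_mulrn ?(ltW x0) // -powRrM divff ?pnatr_eq0 // powRr1 ?(ltW x0).
have -> : y `^ (p - 1) * e * (q * (m%:R * x ^+ k)) = (y * y `^ (p - 1)) / x * (m%:R * e).
  rewrite /y exprS; field; exact: lt0r_neq0.
by rewrite h mulfK ?gt_eqF //; ring.
Qed.

Let mE : measurable_fun setT E.
Proof.
apply: measurableT_comp; first exact: measurable_expR.
apply: measurable_funN; apply: measurable_funM => //; exact: measurable_funX.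
Qed.

Let mG : measurable_fun setT G.
Proof.
apply: measurable_funM; first exact: measurable_powR.
by apply: measurableT_comp; [exact: measurable_expR|exact: measurable_funN].
Qed.

(** Up to 1 the integrand is at most 1; beyond 1, [x ^ m >= x] bounds it by [exp (- q * x)], an
    exponential density divided by [q]. *)
Lemma stretched_exponential_finite : (\int[mu]_(x in `]0%R, +oo[) (E x)%:E < +oo)%E.
Proof.
have mP : measurable_fun setT (exponential_pdf q) by exact: measurable_exponential_pdf.
have p0 x : 0 <= exponential_pdf q x by apply: exponential_pdf_ge0; exact: ltW.
apply: (@le_lt_trans _ _ (\int[mu]_(x in `]0%R, +oo[) ((\1_`[0, 1]%classic x)%:E + (q^-1)%:E * (exponential_pdf q x)%:E))%E).
  apply: ge0_le_integral => //.
  - by move=> x _; rewrite lee_fin expR_ge0.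
  - by apply/measurable_EFinP; exact: measurable_funTS.
  - apply: emeasurable_funD; first by apply/measurable_EFinP; exact: measurable_indic.
    by apply: measurable_funeM; apply/measurable_EFinP; exact: measurable_funTS.
  - move=> x /=; rewrite in_itv /= andbT => x0; rewrite -EFinM -EFinD lee_fin.
    have qp0 : 0 <= q^-1 * exponential_pdf q x by rewrite mulr_ge0 // invr_ge0 ltW.
    have [x1|x1] := leP x 1.
      rewrite indicE mem_set /=; last by rewrite in_itv /= (ltW x0).
      apply: (@le_trans _ _ 1); last by rewrite lerDl.
      by rewrite expR_le1 oppr_le0 mulr_ge0 ?exprn_ge0 // ltW.
    apply: ler_wpDl; first by rewrite indicE ler0n.
    rewrite /exponential_pdf patchE mem_set /=; last by rewrite in_itv /= andbT ltW.
    rewrite mulrA mulVf ?gt_eqF // mul1r ler_expR mulNr lerN2 mulrC ler_wpM2r ?(ltW q0) //.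
    by rewrite exprS ler_peMr ?(ltW x0) // exprn_ege1 // ltW.
rewrite ge0_integralD //=; last 3 first.
- by apply/measurable_EFinP; exact: measurable_indic.
- by move=> x _; rewrite mule_ge0 ?lee_fin // invr_ge0 ltW.
- by apply: measurable_funeM; apply/measurable_EFinP; exact: measurable_funTS.
apply: lte_add_pinfty.
  rewrite integral_indic //.
  apply: (@le_lt_trans _ _ (mu `[0, 1]%classic)); first by apply: le_measure; rewrite ?inE //; exact: measurableI.
  by rewrite lebesgue_measure_itv /= ifT ?lte_fin // oppr0 adde0 ltry.
rewrite ge0_integralZl_EFin //=; last 3 first.
- by move=> x _; rewrite lee_fin.
- by apply/measurable_EFinP; exact: measurable_funTS.
- by rewrite invr_ge0 ltW.
apply: lte_mul_pinfty; rewrite ?lee_fin ?invr_ge0 ?(ltW q0) //.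
apply: (@le_lt_trans _ _ (\int[mu]_x (exponential_pdf q x)%:E)%E).
  apply: ge0_subset_integral => //; first by apply/measurable_EFinP.
  by move=> x _; rewrite lee_fin.
by rewrite integral_exponential_pdf // ltry.
Qed.

(** The integrand of [Gamma] may be singular at 0 and the range is unbounded, so variables are
    changed on the compact intervals [[1 / (i + 1), i + 1]] and both sides are passed to the limit
    by monotone convergence. *)
Let substitution :
  (\int[mu]_(x in `]0%R, +oo[) (G x)%:E =
   (m%:R * q `^ p)%:E * \int[mu]_(x in `]0%R, +oo[) (E x)%:E)%E.
Proof.
pose a (i : nat) : R := i.+1%:R^-1.
pose b (i : nat) : R := i.+1%:R.
have a0 i : 0 < a i by rewrite invr_gt0.
have ab i : a i <= b i by apply: (@le_trans _ _ 1); rewrite ?invf_le1 ?ler1n.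
have Fh : {in Num.pos &, {homo F : x y / x < y}}.
  by move=> x y; rewrite !posrE => x0 y0 xy; rewrite ltr_pM2l // ltr_pXn2r ?nnegrE ?ltW.
have Fle x y : 0 < x -> x <= y -> F x <= F y.
  move=> x0; rewrite le_eqVlt => /predU1P[->//|xy]; apply/ltW/Fh => //; rewrite posrE //; exact: lt_trans xy.
have F0 x : 0 < x -> 0 < F x by move=> x0; rewrite mulr_gt0 // exprn_gt0.
have ha : {homo a : i j / (i <= j)%N >-> j <= i}.
  by move=> i j ij; rewrite lef_pV2 ?posrE // ler_nat ltnS.
have hb : {homo b : i j / (i <= j)%N >-> i <= j}.
  by move=> i j ij; rewrite ler_nat ltnS.
have step i : (\int[mu]_(x in `[F (a i), F (b i)]) (G x)%:E =
    \int[mu]_(x in `[a i, b i]) ((m%:R * q `^ p)%:E * (E x)%:E))%E.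
  rewrite (@integration_by_substitution_increasing _ F G) //.
  - apply: eq_integral => x; rewrite inE /= in_itv /= => /andP[ax _].
    by rewrite -EFinM -GF // (lt_le_trans (a0 i)).
  - move=> x y; rewrite !in_itv /= => /andP[ax _] /andP[ay _].
    by apply: Fh; rewrite posrE; exact: lt_le_trans (a0 i) _.
  - by apply/cvg_ex; exists (F^`()%classic (a i)); apply: cvg_at_right_filter; exact: F1_cont.
  - by apply/cvg_ex; exists (F^`()%classic (b i)); apply: cvg_at_left_filter; exact: F1_cont.
  - have cF x : {for x, continuous F}.
      by apply/differentiable_continuous/derivable1_diffP; apply: ex_derive; exact: derive_F.
    split.
    + by move=> x _; apply: ex_derive; exact: derive_F.
    + by apply: cvg_at_right_filter; exact: cF.
    + by apply: cvg_at_left_filter; exact: cF.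
  - apply: derivable_within_continuous => x; rewrite in_itv /= => /andP[Fx _].
    have x0 : 0 < x by apply: lt_le_trans Fx; exact: F0.
    apply: derivableM.
      by apply: ex_derive; exact: is_derive1_powR.
    exact: ex_derive.
have uab : \bigcup_i `[a i, b i]%classic = `]0, +oo[%classic.
  apply: bigcup_itvcc_gt0 => // x x0.
  exists (maxn (Num.bound x) (Num.bound x^-1)).
  apply/andP; split.
    rewrite invf_ple ?posrE //.
    apply: (@bound_le R); first by rewrite invr_ge0 ltW.
    by rewrite (leq_trans _ (leqnSn _)) // leq_maxr.
  apply: (@bound_le R); first exact: ltW.
  by rewrite (leq_trans _ (leqnSn _)) // leq_maxl.
have uF : \bigcup_i `[F (a i), F (b i)]%classic = `]0, +oo[%classic.
  apply: bigcup_itvcc_gt0 => [i|x x0]; first exact: F0.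
  have bk i : b i <= b i ^+ m by rewrite -[X in X <= _]expr1 ler_weXn2l // ler1n.
  have xq : 0 < x / q by rewrite divr_gt0.
  exists (maxn (Num.bound (x / q)) (Num.bound (x / q)^-1)).
  apply/andP; split.
    rewrite /F exprVn ler_pdivrMr ?exprn_gt0 // -ler_pdivrMl // mulrC.
    rewrite -[q / x]invf_div; apply: le_trans (bk _).
    apply: (@bound_le R); first by rewrite invr_ge0 ltW.
    by rewrite (leq_trans _ (leqnSn _)) // leq_maxr.
  rewrite /F -ler_pdivrMl // mulrC; apply: le_trans (bk _).
  apply: (@bound_le R); first exact: ltW.
  by rewrite (leq_trans _ (leqnSn _)) // leq_maxl.
have C0 : 0 <= m%:R * q `^ p by rewrite mulr_ge0 // powR_ge0.
have lim1 : (\int[mu]_(x in `[F (a i), F (b i)]) (G x)%:E @[i --> \oo] --> \int[mu]_(x in `]0%R, +oo[) (G x)%:E)%E.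
  rewrite -uF; apply: ge0_nondecreasing_set_cvg_integral.
  - apply: itvcc_nondecreasing => i j ij; apply: Fle => //; [exact: ha|exact: hb].
  - by move=> i; exact: measurable_itv.
  - by move=> i; apply/measurable_EFinP; exact: measurable_funTS.
  - by move=> i x _; rewrite lee_fin mulr_ge0 ?powR_ge0 ?expR_ge0.
have lim2 : (\int[mu]_(x in `[F (a i), F (b i)]) (G x)%:E @[i --> \oo] -->
    \int[mu]_(x in `]0%R, +oo[) ((m%:R * q `^ p)%:E * (E x)%:E))%E.
  rewrite (eq_cvg _ _ step) -uab; apply: ge0_nondecreasing_set_cvg_integral.
  - exact: itvcc_nondecreasing.
  - by move=> i; exact: measurable_itv.
  - by move=> i; apply: measurable_funeM; apply/measurable_EFinP; exact: measurable_funTS.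
  - by move=> i x _; rewrite mule_ge0 ?lee_fin ?expR_ge0.
rewrite (cvg_unique _ lim1 lim2) // ge0_integralZl_EFin //.
- by move=> x _; rewrite lee_fin expR_ge0.
- by apply/measurable_EFinP; exact: measurable_funTS.
Qed.

Lemma integral_stretched_exponential :
  (\int[mu]_(x in `[0%R, +oo[) (expR (- (x ^+ k.+1 * q)))%:E =
   (q `^ (- k.+1%:R^-1) * (Gamma (k.+1%:R^-1 : R) / k.+1%:R))%:E)%E.
Proof.
rewrite -integral_itv_obnd_cbnd; last by apply/measurable_EFinP; exact: measurable_funTS.
rewrite -/(\int[mu]_(x in `]0%R, +oo[) (E x)%:E)%E.
(* [Gamma] is a real-valued integral, that is [fine] of the extended one, so finiteness is needed to
   carry the identity over. *)
have fin : (\int[mu]_(x in `]0%R, +oo[) (E x)%:E \is a fin_num)%E.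
  rewrite ge0_fin_numE ?stretched_exponential_finite //.
  by apply: integral_ge0 => x _; rewrite lee_fin expR_ge0.
rewrite -(fineK fin); congr EFin.
have -> : Gamma p = fine (\int[mu]_(x in `]0%R, +oo[) (G x)%:E)%E by [].
rewrite substitution -[in RHS](fineK fin) -EFinM /= powRN.
have qp : 0 < q `^ p by rewrite powR_gt0.
field; rewrite gt_eqF // gt_eqF //= ?ltr0n //.
Qed.

End StretchedExponential.

(** The common form of the integral comparisons below: a main term [g1], an additive error [e]
    confined to [[0, y]], and a small multiple of an integrable tail [g2]. *)
Lemma integral_split_le (R : realType) (f g1 g2 : R -> R) (e y c : R) :
  measurable_fun setT f -> measurable_fun setT g1 -> measurable_fun setT g2 ->
  (forall x, 0 <= f x) -> (forall x, 0 <= g1 x) -> (forall x, 0 <= g2 x) ->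
  0 <= e -> 0 <= y -> 0 <= c ->
  (forall x, 0 <= x -> f x <= g1 x + e * (x <= y)%R%:R + c * g2 x) ->
  (\int[lebesgue_measure]_(x in `[0%R, +oo[) (f x)%:E <=
   \int[lebesgue_measure]_(x in `[0%R, +oo[) (g1 x)%:E + (e * y)%:E +
   c%:E * \int[lebesgue_measure]_(x in `[0%R, +oo[) (g2 x)%:E)%E.
Proof.
move=> mf mg1 mg2 f0 g10 g20 e0 y0 c0 fle.
pose D : set R := `[0%R, +oo[%classic.
have mD : measurable D by exact: measurable_itv.
have mE (g : R -> R) : measurable_fun setT g -> measurable_fun D (EFin \o g).
  by move=> mg; apply/measurable_EFinP; exact: measurable_funTS.
have m1 : measurable_fun setT (\1_`[0, y]%classic : R -> R) by exact: measurable_indic.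
have i1 : (\int[lebesgue_measure]_(x in D) (e%:E * (\1_`[0, y]%classic x)%:E) = (e * y)%:E)%E.
  rewrite ge0_integralZl_EFin //; try exact: mE.
  rewrite integral_indic //.
  rewrite (_ : `[0, y]%classic `&` D = `[0, y]%classic); last first.
    apply/seteqP; split => [x []//|x] /= h; split => //.
    by move: h; rewrite /D /= !in_itv /= => /andP[->].
  have E : lebesgue_measure `[0, y]%classic = y%:E.
    rewrite lebesgue_measure_itv /= lte_fin.
    case: ltP => [_|y'0]; first by rewrite oppr0 adde0.
    by congr EFin; apply/eqP; rewrite eq_le y0 y'0.
  by rewrite EFinM; congr (_ * _)%E; exact: E.
have i2 : (\int[lebesgue_measure]_(x in D) (c%:E * (g2 x)%:E) = c%:E * \int[lebesgue_measure]_(x in D) (g2 x)%:E)%E.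
  by rewrite ge0_integralZl_EFin //; try exact: mE; move=> x _; rewrite lee_fin.
have m2 : measurable_fun D (fun x => e%:E * (\1_`[0, y]%classic x)%:E)%E.
  by apply: measurable_funeM; exact: mE.
have m3 : measurable_fun D (fun x => c%:E * (g2 x)%:E)%E.
  by apply: measurable_funeM; exact: mE.
have p2 x : (0 <= e%:E * (\1_`[0, y]%classic x)%:E)%E by rewrite mule_ge0 ?lee_fin // indicE ler0n.
have p3 x : (0 <= c%:E * (g2 x)%:E)%E by rewrite mule_ge0 ?lee_fin.
have p1 x : (0 <= (g1 x)%:E)%E by rewrite lee_fin.
have p12 x : (0 <= (g1 x)%:E + e%:E * (\1_`[0, y]%classic x)%:E)%E by rewrite adde_ge0.
have m12 : measurable_fun D (fun x => (g1 x)%:E + e%:E * (\1_`[0, y]%classic x)%:E)%E.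
  by apply: emeasurable_funD => //; exact: mE.
rewrite -i1 -i2 -ge0_integralD //; try exact: mE.
rewrite -ge0_integralD //.
apply: ge0_le_integral => //.
- by move=> x _; rewrite lee_fin.
- exact: mE.
- by apply: emeasurable_funD => //; apply: emeasurable_funD => //; exact: mE.
- move=> x; rewrite /D /= in_itv /= andbT => x0.
  rewrite -!EFinM -!EFinD lee_fin; apply: (le_trans (fle x x0)).
  rewrite lerD2r lerD2l ler_wpM2l // indicE ler_nat.
  by case: leP => // xy; rewrite mem_set //= in_itv /= x0 xy.
Qed.

Lemma exists_subset (T : finType) (U : {set T}) k : (k <= #|U|)%N ->
  exists2 V : {set T}, V \subset U & #|V| = k.
Proof.
rewrite -bin_gt0 -cards_draws => /card_gt0P[V]; rewrite inE => /andP[VU /eqP Vk].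
by exists V.
Qed.

Lemma exists_halves (T : finType) (U : {set T}) :
  exists V1 V2 : {set T}, [/\ V1 \subset U, V2 \subset U, [disjoint V1 & V2]%B,
    #|V1| = #|U|./2 & #|V2| = #|U|./2].
Proof.
have h : (#|U|./2 <= #|U|)%N by rewrite leq_half_double -addnn leqW // leq_addr.
have [V1 V1U V1k] := exists_subset h.
have h2 : (#|U|./2 <= #|(U :\: V1)%SET|)%N.
  rewrite cardsD (finset.setIidPr V1U) V1k leq_subRL //.
  by rewrite addnn -[leqRHS]odd_double_half leq_addl.
have [V2] := exists_subset h2; rewrite finset.subsetD => /andP[V2U dV] V2k.
by exists V1, V2; split => //; rewrite disjoint_sym.
Qed.

(** * The integral of the avoidance probability over all levels *)

Section AvoidIntegral.
Context {R : realType} {d0 : measure_display} {Omega0 : measurableType d0}.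
Context {P0 : probability Omega0 R} (X : {RV P0 >-> R}).
Hypothesis X_ge0 : forall t, 0 <= X t.
Hypothesis X_int : P0.-integrable [set: Omega0] (EFin \o X).
Hypothesis F_cont : continuous (dist_fun X).
Hypothesis F_slope : has_right_derivative (dist_fun X) 0 1.
Context {T : finType} (H : graph T).
Hypothesis balancedH : strictly_balanced H.
Hypothesis edgeH : (0 < nedges H)%N.

Local Notation m := (nedges H).
Local Notation v := (nverts H).
Local Notation a := (nauto H).

Definition avoid_integral {d : measure_display} {Omega : measurableType d} (P : probability Omega R)
    {n : nat} (w : {set 'I_n} -> {RV P >-> R}) (U : {set 'I_n}) : \bar R :=
  (\int[lebesgue_measure]_(x in `[0%R, +oo[) (pr P (avoid H w U x))%:E)%E.

Lemma measurable_avoid {d : measure_display} {Omega : measurableType d} (P : probability Omega R)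
    {n : nat} (w : {set 'I_n} -> {RV P >-> R}) (U : {set 'I_n}) :
  measurable_fun setT (fun x => pr P (avoid H w U x)).
Proof. by apply: nonincreasing_measurable => // x y xy; exact: le_avoid. Qed.

(** Up to [y] the probability is bounded by 1. Beyond [y] it is at most the product over the two
    parts, whose first factor is at most its value at [y]. *)
Lemma avoid_integral_halves {d : measure_display} {Omega : measurableType d} (P : probability Omega R)
    {n : nat} (w : {set 'I_n} -> {RV P >-> R}) (U U1 U2 : {set 'I_n}) (y : R) :
  iid_copies_in X (edges (complete_graph n)) w ->
  U1 \subset U -> U2 \subset U -> [disjoint U1 & U2]%B -> 0 <= y ->
  (avoid_integral w U <= y%:E + (pr P (avoid H w U1 y))%:E * avoid_integral w U2)%E.
Proof.
move=> iid s1 s2 dU y0.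
have := @integral_split_le R (fun x => pr P (avoid H w U x)) (fun=> 0) (fun x => pr P (avoid H w U2 x))
  1 y (pr P (avoid H w U1 y)) (measurable_avoid _ _) (measurable_cst _) (measurable_avoid _ _).
rewrite integral0 add0e mul1r; apply => //; try by move=> x; exact: pr_ge0.
  exact: pr_ge0.
move=> x x0; rewrite add0r mul1r.
have [xy|yx] := leP x y.
  apply: (@le_trans _ _ 1); first exact/pr_le1/avoid_measurable.
  by rewrite lerDl mulr_ge0 ?pr_ge0.
rewrite add0r; apply: (le_trans (avoid_halves H iid x s1 s2 dU)).
by rewrite ler_wpM2r ?pr_ge0 // le_avoid // ltW.
Qed.

(** A single copy in [U] is enough: if its weight is at least [x], then almost surely one of its [m]
    edges has weight above [x / (2 * m)]. Hence the tail is at most [m] times that of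
    [Y = 2 * m * X], whose integral is the expectation of [Y]; the bound does not depend on [U]. *)
Lemma avoid_integral_finite : exists B : R,
  forall (d : measure_display) (Omega : measurableType d)
    (P : probability Omega R) (n : nat) (w : {set 'I_n} -> {RV P >-> R}) (U : {set 'I_n}),
  iid_copies_in X (edges (complete_graph n)) w -> (v <= #|U|)%N ->
  (avoid_integral w U <= B%:E)%E.
Proof.
have m0 : 0 < m%:R :> R by rewrite ltr0n.
have k0 : 0 < 2 * m%:R :> R by rewrite mulr_gt0.
pose Y : {RV P0 >-> R} := (2 * m%:R : R) \o* X.
have XL : (X : Omega0 -> R) \in Lfun P0 1 by apply/Lfun1_integrable.
have EY : ('E_P0[Y])%E \is a fin_num by rewrite expectationZl // fin_numM // expectation_fin_num.
have Y0 t : 0 <= Y t by rewrite /Y /= mulr_ge0 // ltW.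
pose g x : R := pr P0 (Y @^-1` `]x, +oo[).
have mY B : measurable B -> measurable (Y @^-1` B) by exact: (measurable_preimage_rv (fun=> Y) tt).
have gE x : (g x)%:E = ccdf Y x.
  by rewrite /g -prE //; apply: mY.
have mg : measurable_fun setT g.
  by apply: nonincreasing_measurable => // x y xy; apply: le_pr; try exact: mY;
    move=> t /=; rewrite !in_itv /= !andbT; exact: le_lt_trans.
have Ig : (\int[lebesgue_measure]_(x in `[0%R, +oo[) (g x)%:E)%E = ('E_P0[Y])%E.
  by rewrite ge0_expectation_ccdf //; apply: eq_integral => x _; exact: gE.
exists (m%:R * fine ('E_P0[Y])%E) => d Omega P n w U iid vU.
rewrite EFinM fineK // -Ig.
have := @integral_split_le R (fun x => pr P (avoid H w U x)) (fun=> 0) g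
  0 0 m%:R (measurable_avoid _ _) (measurable_cst _) mg.
rewrite integral0 mul0r !add0e; apply => //; try by move=> x; exact: pr_ge0.
move=> x x0; rewrite add0r mul0r add0r.
have n0 : (0 < n)%N.
  apply: leq_trans (_ : (#|U| <= n)%N); first exact: leq_trans (v_gt0 edgeH) vU.
  by rewrite -[n in (_ <= n)%N]card_ord max_card.
have [G Gc] : exists G, G \in copies_in H U.
  apply/card_gt0P; have := card_copies_in H U n0.
  by case: #|copies_in H U| => // /esym/eqP; rewrite mul0n -leqn0 leqNgt ffact_gt0 vU.
have GC : G \in copies H n by move: Gc; rewrite mem_copies_in => /andP[].
have GD : edges G \subset edges (complete_graph n) by exact: copy_edges_sub.
(* The factor 2 leaves room for strictness: [m] positive weights at most [z] sum to at most [x / 2],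
   which is less than [x] because [z] is then positive. *)
pose z := x / (2 * m%:R).
pose V := \big[setU/set0]_(e in edges G) (w e @^-1` `]z, +oo[).
pose Z := \big[setU/set0]_(e in edges G) (w e @^-1` `]-oo, 0]).
have mV : measurable V by apply: bigsetU_measurable => e _; exact: measurable_preimage_rv.
have mZ : measurable Z by apply: bigsetU_measurable => e _; exact: measurable_preimage_rv.
have sub : avoid H w U x `<=` V `|` Z.
  move=> t h; apply: contrapT => /not_orP[nV nZ].
  have wp e : e \in edges G -> 0 < w e t.
    move=> eE; rewrite ltNge; apply/negP => we; apply: nZ.
    by rewrite /Z -bigcup_seq_cond; exists e; rewrite /= ?mem_index_enum ?eE // in_itv.
  have wz e : e \in edges G -> w e t <= z.
    move=> eE; rewrite leNgt; apply/negP => we; apply: nV.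
    by rewrite /V -bigcup_seq_cond; exists e; rewrite /= ?mem_index_enum ?eE // in_itv /= andbT.
  have [e eE] : exists e, e \in edges G by apply/card_gt0P; rewrite (copy_nedges GC).
  have z0 : 0 < z := lt_le_trans (wp e eE) (wz e eE).
  have := h G Gc; rewrite /weight leNgt => /negP; apply.
  apply: (@le_lt_trans _ _ (\sum_(e in edges G) z)); first exact: ler_sum.
  rewrite sumr_const (copy_nedges GC) -mulr_natl.
  have xE : x = 2 * (m%:R * z) by rewrite mulrA mulrC divfK // gt_eqF.
  have mz : 0 < m%:R * z by rewrite mulr_gt0.
  rewrite [X in _ < X]xE [X in _ < X]mulr_natl mulr2n ltrDl; exact: mz.
apply: (le_trans (le_pr _ (avoid_measurable _ _ _ _) _ sub)); first exact: measurableU.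
apply: (le_trans (pr_setU_le _ mV mZ)).
have -> : m%:R * g x = m%:R * g x + 0 by rewrite addr0.
apply: lerD.
  apply: le_trans (pr_bigcup_le _ _ _ _) _; first by move=> e; exact: measurable_preimage_rv.
  apply: (@le_trans _ _ (\sum_(e in edges G) g x)); last first.
    by rewrite sumr_const (copy_nedges GC) mulr_natl.
  apply: ler_sum => e eE; rewrite (iid_pr iid) ?(fintype.subsetP GD) //.
  apply: le_pr; [exact: measurable_preimage_rv (fun=> X) tt _ _|exact: mY|].
  move=> t /=; rewrite !in_itv /= !andbT /z ltr_pdivrMr //.
apply: le_trans (pr_bigcup_le _ _ _ _) _; first by move=> e; exact: measurable_preimage_rv.
rewrite big1 // => e eE; rewrite (iid_pr_le0 X_ge0 F_cont iid) //.
exact: (fintype.subsetP GD).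
Qed.

End AvoidIntegral.

(** In this and the next two lemmas [kn], [kk] and [k3] stand for [kappa] of a size, of half that
    size, and of 3. After scaling by [kn], the level [Y] and the term with [th] each account for at
    most [A / 2]. *)
Lemma halving_step (R : realFieldType) (Y A th kn kk k3 : R) :
  0 < kn -> 0 < kk -> 0 < k3 -> kn <= k3 * kk -> 0 <= Y -> 0 <= A ->
  2 * k3 * Y <= A -> th = (2 * k3)^-1 ->
  Y / kk + th * (A / kk) <= A / kn.
Proof.
move=> kn0 kk0 k30 le Y0 A0 YA ->.
have i0 : 0 < kk^-1 by rewrite invr_gt0.
have j0 : 0 < k3^-1 by rewrite invr_gt0.
rewrite ler_pdivlMr // invfM.
have h : kn / kk <= k3 by rewrite ler_pdivrMr.
have -> : (Y / kk + 2^-1 / k3 * (A / kk)) * kn = (Y + 2^-1 / k3 * A) * (kn / kk) by ring.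
have B0 : 0 <= Y + 2^-1 / k3 * A by rewrite addr_ge0 // !mulr_ge0 ?invr_ge0 // ltW.
apply: (le_trans (ler_wpM2l B0 h)); rewrite mulrDl.
have -> : 2^-1 / k3 * A * k3 = A / 2 by field; exact: lt0r_neq0.
lra.
Qed.

Lemma scaled_upper (R : realFieldType) (J g e Y E A t kn kk k3 : R) :
  0 < kn -> 0 < kk -> kn <= k3 * kk -> 0 <= Y -> 0 <= A -> 0 <= e -> 0 <= E ->
  t <= E + e -> J <= g / kn + e * (Y / kk) + t * (A / kk) ->
  kn * J <= g + (k3 * (Y + A) * e + k3 * A * E).
Proof.
move=> kn0 kk0 le Y0 A0 e0 E0 tE JJ.
have h : kn / kk <= k3 by rewrite ler_pdivrMr.
have Ak : 0 <= A / kk by rewrite divr_ge0 // ltW.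
have {JJ} := le_trans JJ (lerD (lexx _) (ler_wpM2r Ak tE)).
move=> /(ler_wpM2l (ltW kn0)) JJ; apply: (le_trans JJ).
have -> : kn * (g / kn + e * (Y / kk) + (E + e) * (A / kk)) =
   g + (e * Y + (E + e) * A) * (kn / kk) by field; rewrite !lt0r_neq0.
rewrite lerD2l.
have B0 : 0 <= e * Y + (E + e) * A by rewrite addr_ge0 // mulr_ge0 // addr_ge0.
apply: (le_trans (ler_wpM2l B0 h)); lra.
Qed.

Lemma scaled_lower (R : realFieldType) (J g g2 e Y E kn kk k3 : R) :
  0 < kn -> 0 < kk -> kn <= k3 * kk -> 0 <= Y -> 0 <= e ->
  g / kn <= J + e * (Y / kk) + E * (g2 / kn) ->
  g <= kn * J + (k3 * Y * e + g2 * E).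
Proof.
move=> kn0 kk0 le Y0 e0 /(ler_wpM2l (ltW kn0)).
have h : kn / kk <= k3 by rewrite ler_pdivrMr.
rewrite mulrC divfK ?gt_eqF // => JJ; apply: (le_trans JJ).
have -> : kn * (J + e * (Y / kk) + E * (g2 / kn)) = kn * J + ((e * Y) * (kn / kk) + g2 * E).
  by field; rewrite !lt0r_neq0.
have := ler_wpM2l (mulr_ge0 e0 Y0) h; lra.
Qed.

(** Equality occurs at [s = 3]; hence the constant [kappa 3] as the price of one halving. *)
Lemma halves_size (s k : nat) : (0 < k)%N -> k = s./2 -> (s <= 3 * k)%N.
Proof. by move=> k0 kE; have := odd_double_half s; rewrite -kE -addnn; case: (odd s) => /=; lia. Qed.

Section ExpectationLimit.
Context {R : realType} {d0 : measure_display} {Omega0 : measurableType d0}.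
Context {P0 : probability Omega0 R} (X : {RV P0 >-> R}).
Hypothesis X_ge0 : forall t, 0 <= X t.
Hypothesis X_int : P0.-integrable [set: Omega0] (EFin \o X).
Hypothesis F_cont : continuous (dist_fun X).
Hypothesis F_slope : has_right_derivative (dist_fun X) 0 1.
Context {T : finType} (H : graph T).
Hypothesis balancedH : strictly_balanced H.
Hypothesis edgeH : (0 < nedges H)%N.

Local Notation m := (nedges H).
Local Notation v := (nverts H).
Local Notation a := (nauto H).
Local Notation c := ((m`! * a)%:R : R).

(** The normalisation [s ^ (1 / d)] of the theorem, as [d = m / v]. *)
Definition kappa (s : nat) : R := s%:R `^ (v%:R / m%:R).

Lemma kappa_gt0 s : (0 < s)%N -> 0 < kappa s.
Proof. by move=> s0; rewrite powR_gt0 // ltr0n. Qed.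

Lemma kappaX s : kappa s ^+ m = s%:R ^+ v.
Proof.
rewrite -powR_mulrn ?powR_ge0 // -powRrM divfK ?powR_mulrn //.
by rewrite pnatr_eq0 -lt0n.
Qed.

Lemma le_kappa s t : (s <= t)%N -> kappa s <= kappa t.
Proof.
by move=> st; rewrite ge0_ler_powR ?nnegrE ?divr_ge0 // ler_nat.
Qed.

Lemma kappa3 s k : (s <= 3 * k)%N -> kappa s <= kappa 3 * kappa k.
Proof. by move=> sk; rewrite /kappa -powRM // -natrM; exact: le_kappa. Qed.

Lemma c_gt0 : 0 < c.
Proof. by rewrite ltr0n muln_gt0 fact_gt0 nauto_gt0. Qed.

Lemma exp_level (b e : R) : 0 < b -> 0 < e ->
  exists2 Y : R, 0 <= Y & expR (- (Y ^+ m / b)) <= e.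
Proof.
move=> b0 e0; have [] := @exists_root R m (b * (2 / (2 * e))) edgeH.
  by rewrite mulr_ge0 ?divr_ge0 ?mulr_ge0 // ltW.
move=> Y Y0 YE; exists Y => //; rewrite YE mulrAC divff ?gt_eqF // mul1r.
have := @expR_small R (2 * e); rewrite mulr_gt0 // => /(_ isT).
by rewrite [2 * e / 2]mulrAC divff ?mul1r // pnatr_eq0.
Qed.

Lemma level_kappa (Y : R) k : (0 < k)%N -> (Y / kappa k) ^+ m * k%:R ^+ v = Y ^+ m.
Proof. by move=> k0; rewrite expr_div_n kappaX divfK // expf_neq0 // pnatr_eq0 -lt0n. Qed.

(** Strong induction on [#|U|]. The level [Y / kappa h] of a half is chosen so high that avoidance
    there has probability at most [th], which outweighs the loss [kappa 3] of a halving. *)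
Lemma avoid_integral_bound : exists (s1 : nat) (A : R), 0 <= A /\
  forall (d : measure_display) (Omega : measurableType d)
    (P : probability Omega R) (n : nat) (w : {set 'I_n} -> {RV P >-> R}) (U : {set 'I_n}),
  iid_copies_in X (edges (complete_graph n)) w -> (s1 <= #|U|)%N ->
  (avoid_integral H w U <= (A / kappa #|U|)%:E)%E.
Proof.
have k30 : 0 < kappa 3 by exact: kappa_gt0.
pose th := (2 * kappa 3)^-1.
have th0 : 0 < th by rewrite invr_gt0 mulr_gt0.
have th20 : 0 < th / 2 by rewrite divr_gt0.
have [s0 hs0] := avoid_asymp X_ge0 F_cont F_slope balancedH edgeH th20.
have [Y Y0 hY] := exp_level c_gt0 th20.
have [B hB] := avoid_integral_finite X_ge0 X_int F_cont edgeH.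
pose s1 := maxn (maxn s0 v) 1.
(* The first entry makes [halving_step] applicable; the second covers the sets smaller than
   [2 * s1], where the uniform bound [B] is used. *)
pose A := Num.max (2 * kappa 3 * Y) (`|B| * kappa (2 * s1)).
have A0 : 0 <= A by rewrite le_max mulr_ge0 // mulr_ge0 // ltW.
exists s1, A; split => // d Omega P n w U iid.
have [k] := ubnP #|U|; elim: k U => // k IH U; rewrite ltnS => Uk sU.
have U0 : (0 < #|U|)%N by apply: leq_trans sU; rewrite leq_maxr.
have [small|big] := ltnP #|U| (2 * s1).
  have vU : (v <= #|U|)%N by apply: leq_trans sU; rewrite leq_max leq_maxr.
  apply: (le_trans (hB _ _ _ _ _ _ iid vU)); rewrite lee_fin.
  rewrite ler_pdivlMr ?kappa_gt0 // le_max; apply/orP; right.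
  apply: (le_trans (ler_wpM2r (ltW (kappa_gt0 U0)) (ler_norm B))).
  by rewrite ler_wpM2l // le_kappa // ltnW.
have [U1 [U2 [S1 S2 dU k1 k2]]] := exists_halves U.
set h := #|U|./2 in k1 k2.
have hs : (s1 <= h)%N by rewrite /h geq_half_double -mul2n.
have h0 : (0 < h)%N by apply: leq_trans hs; rewrite leq_maxr.
have h3 : (#|U| <= 3 * h)%N by exact: halves_size.
have hU : (h < #|U|)%N by rewrite /h ltn_half_double -addnn -[X in (X < _)%N]addn0 ltn_add2l.
have y0 : 0 <= Y / kappa h by rewrite divr_ge0 // ltW // kappa_gt0.
apply: (le_trans (avoid_integral_halves H iid S1 S2 dU y0)).
have p1 : pr P (avoid H w U1 (Y / kappa h)) <= th.
  have s0U1 : (s0 <= #|U1|)%N by rewrite k1; apply: leq_trans hs; rewrite !leq_max leqnn.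
  have := hs0 _ _ _ _ _ U1 iid s0U1 _ y0; rewrite k1 level_kappa // ler_norml => /andP[_ q].
  by move: q; rewrite lerBlDr => /le_trans; apply; rewrite [leRHS]splitr lerD2l.
have I2 := IH U2; rewrite k2 in I2.
have {}I2 := I2 (leq_trans hU Uk) hs.
apply: (@le_trans _ _ ((Y / kappa h)%:E + th%:E * (A / kappa h)%:E)%E).
  rewrite leeD2lE // ; apply: lee_pmul => //; rewrite ?lee_fin ?pr_ge0 //.
  by apply: integral_ge0 => x _; rewrite lee_fin pr_ge0.
rewrite -EFinM -EFinD lee_fin; apply: (halving_step _ _ k30 (kappa3 h3)) => //; rewrite ?kappa_gt0 //.
by rewrite le_max lexx.
Qed.

End ExpectationLimit.

Lemma final_bound (R : realFieldType) (J g u1 u2 u3 u4 del : R) :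
  u1 <= del / 4 -> u2 <= del / 4 -> u3 <= del / 4 -> u4 <= del / 4 -> 0 < del ->
  J <= g + (u1 + u2) -> g <= J + (u3 + u4) -> `|J - g| <= del.
Proof. by move=> ? ? ? ? ? ? ?; rewrite ler_norml; apply/andP; split; lra. Qed.

Lemma mean_rearrange (R : fieldType) (b k g m : R) :
  b / k * (g / m) = b / m * g / k.
Proof. by ring. Qed.

Lemma kappa1 (R : realType) (T : finType) (H : graph T) : @kappa R T H 1 = 1.
Proof. by rewrite /kappa powR1. Qed.

(** * Convergence of the scaled integral to the mean of the limit law *)

Section ScaledLimit.
Context {R : realType} {d0 : measure_display} {Omega0 : measurableType d0}.
Context {P0 : probability Omega0 R} (X : {RV P0 >-> R}).
Hypothesis X_ge0 : forall t, 0 <= X t.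
Hypothesis X_int : P0.-integrable [set: Omega0] (EFin \o X).
Hypothesis F_cont : continuous (dist_fun X).
Hypothesis F_slope : has_right_derivative (dist_fun X) 0 1.
Context {T : finType} (H : graph T).
Hypothesis balancedH : strictly_balanced H.
Hypothesis edgeH : (0 < nedges H)%N.

Local Notation m := (nedges H).
Local Notation v := (nverts H).
Local Notation a := (nauto H).
Local Notation c := ((m`! * a)%:R : R).
Local Notation kappa := (@kappa R T H).

(** For [b = c] this is the limiting avoidance probability of a set of [s] vertices; [b = 2 * c]
    gives its square root. *)
Definition limit_profile (b : R) (s : nat) (x : R) : R := expR (- (x ^+ m * s%:R ^+ v / b)).

Definition limit_mean (b : R) : R := b `^ m%:R^-1 / m%:R * Gamma (m%:R^-1 : R).

Lemma limit_profile_ge0 b s x : 0 <= limit_profile b s x.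
Proof. exact: expR_ge0. Qed.

Lemma limit_profile_measurable b s : measurable_fun setT (limit_profile b s).
Proof.
apply: measurableT_comp; first exact: measurable_expR.
apply: measurable_funN; by apply: measurable_funM => //; apply: measurable_funM => //.
Qed.

Lemma limit_profile_continuous b s : continuous (limit_profile b s).
Proof.
move=> x; have h : {for x, continuous (expR \o (fun z : R => - (z ^+ m * s%:R ^+ v / b)))}.
  apply: continuous_comp; last exact: continuous_expR.
  apply: cvgN; apply: cvgM; last exact: cvg_cst.
  by apply: cvgM; [exact: exprn_continuous|exact: cvg_cst].
exact: h.
Qed.

Lemma integral_limit_profile b s : 0 < b -> (0 < s)%N ->
  (\int[lebesgue_measure]_(x in `[0%R, +oo[) (limit_profile b s x)%:E =
   (limit_mean b / kappa s)%:E)%E.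
Proof.
move=> b0 s0; have k0 : 0 < kappa s := kappa_gt0 H s0.
have [k mE] : exists k, m = k.+1 by exists m.-1; rewrite prednK.
(* Chosen with [t ^ m = s ^ v / b], so that the parameter [q = t ^ m] contributes exactly [1 / t] to
   the integral. *)
pose t : R := kappa s / b `^ m%:R^-1.
have bm0 : 0 < b `^ m%:R^-1 by rewrite powR_gt0.
have t0 : 0 < t by rewrite divr_gt0.
have tm : t ^+ m = s%:R ^+ v / b.
  have bE : (b `^ m%:R^-1) ^+ m = b.
    by rewrite -powR_mulrn ?powR_ge0 // -powRrM mulVf ?powRr1 ?(ltW b0) // pnatr_eq0 -lt0n.
  by rewrite expr_div_n kappaX // bE.
have q0 : 0 < t ^+ m by rewrite exprn_gt0.
transitivity (\int[lebesgue_measure]_(x in `[0%R, +oo[) (expR (- (x ^+ k.+1 * t ^+ m)))%:E)%E.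
  by apply: eq_integral => x _; rewrite /limit_profile tm -mE mulrA.
rewrite integral_stretched_exponential // -mE; congr EFin.
have -> : (t ^+ m) `^ (- m%:R^-1) = t^-1.
  rewrite -(powR_mulrn _ (ltW t0)) -powRrM mulrN divff ?pnatr_eq0 -?lt0n //.
  by rewrite powR_inv1 ?(ltW t0).
rewrite /t invf_div /limit_mean; exact: mean_rearrange.
Qed.

(** Positivity, including that of [Gamma (1 / m)], is read off the integral for [s = 1], whose
    integrand is at least [exp (- 1 / b)] on [[0, 1]]. *)
Lemma limit_mean_gt0 b : 0 < b -> 0 < limit_mean b.
Proof.
move=> b0; have := integral_limit_profile b0 (ltn0Sn 0).
rewrite kappa1 divr1 => E.
rewrite -lte_fin -E.
apply: (@lt_le_trans _ _ (\int[lebesgue_measure]_(x in `[0%R, 1%R]) (cst (expR (- b^-1))%:E) x)%E).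
  rewrite integral_cst //.
  have -> : lebesgue_measure_lebesgue_measure__canonical__measure_function_Measure R `[0%R, 1%R]%classic = 1%:E.
    have h : lebesgue_measure (`[0%R, 1%R]%classic : set R) = 1%:E.
      by rewrite lebesgue_measure_itv /= lte_fin ltr01 oppr0 adde0.
    exact: h.
  by rewrite mule1 lte_fin expR_gt0.
apply: (@le_trans _ _ (\int[lebesgue_measure]_(x in `[0%R, 1%R]) (limit_profile b 1 x)%:E)%E).
  apply: ge0_le_integral => //.
  - by move=> x _; rewrite lee_fin expR_ge0.
  - by apply/measurable_EFinP; apply: measurable_funTS; exact: limit_profile_measurable.
  - move=> x /=; rewrite in_itv /= => /andP[x0 x1].
    rewrite lee_fin /limit_profile expr1n mulr1 ler_expR lerN2 ler_pdivrMr // mulVf ?gt_eqF //.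
    exact: exprn_ile1.
apply: ge0_subset_integral => //.
- by apply/measurable_EFinP; apply: measurable_funTS; exact: limit_profile_measurable.
- by move=> x _; rewrite lee_fin limit_profile_ge0.
- by move=> x /=; rewrite !in_itv /= andbT => /andP[].
Qed.

Lemma limit_profile_le b s t x : 0 < b -> (s <= t)%N -> 0 <= x ->
  limit_profile b t x <= limit_profile b s x.
Proof.
move=> b0 st x0; rewrite ler_expR lerN2 ler_pM2r ?invr_gt0 // ler_wpM2l ?exprn_ge0 //.
by rewrite lerXn2r ?nnegrE // ler_nat.
Qed.

Lemma limit_profile_ler b s x y : 0 < b -> 0 <= x -> x <= y ->
  limit_profile b s y <= limit_profile b s x.
Proof.
move=> b0 x0 xy; rewrite ler_expR lerN2 ler_pM2r ?invr_gt0 // ler_wpM2r ?exprn_ge0 //.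
by rewrite lerXn2r ?nnegrE // (le_trans x0).
Qed.

(** Splits the profile beyond a level into a small factor and a factor that is still integrable. *)
Lemma limit_profile_double b s x : 
  limit_profile b s x = limit_profile (2 * b) s x * limit_profile (2 * b) s x.
Proof.
rewrite -expRD -opprD; congr (expR (- _)).
by rewrite invfM !mulrA [_ / 2]mulrC -!mulrA -mulrDl -[2^-1]mul1r -splitr mul1r.
Qed.

(* [h] will be the tail function of the minimum weight, for which only strict
   inequalities are available. *)
Lemma scaled_limit (del : R) : 0 < del -> exists s2 : nat,
  forall (d : measure_display) (Omega : measurableType d)
    (P : probability Omega R) (n : nat) (w : {set 'I_n} -> {RV P >-> R}),
  iid_copies_in X (edges (complete_graph n)) w -> (s2 <= n)%N ->
  forall h : R -> R, measurable_fun setT h -> (forall x, 0 <= h x) ->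
  (forall x, 0 <= x -> h x <= pr P (avoid H w [set: 'I_n]%SET x)) ->
  (forall x y, 0 <= x -> x < y -> pr P (avoid H w [set: 'I_n]%SET y) <= h x) ->
  exists2 J : R, (\int[lebesgue_measure]_(x in `[0%R, +oo[) (h x)%:E = J%:E)%E &
    `|kappa n * J - limit_mean c| <= del.
Proof.
move=> del0; have c0 : 0 < c := c_gt0 H.
have c20 : 0 < 2 * c by rewrite mulr_gt0.
have k30 : 0 < kappa 3 := kappa_gt0 H (ltn0Sn 2).
have g0 := limit_mean_gt0 c0; set g := limit_mean c in g0 *.
have g20 := limit_mean_gt0 c20; set g2 := limit_mean (2 * c) in g20 *.
have [s1 [A [A0 hA]]] := avoid_integral_bound X_ge0 X_int F_cont F_slope balancedH edgeH.
have k3A : 0 <= kappa 3 * A by rewrite mulr_ge0 // ltW.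
have B0 : 0 <= kappa 3 * A + g2 by rewrite addr_ge0 // ltW.
pose eta := del / (4 * (kappa 3 * A + g2 + 1)).
have eta0 : 0 < eta by rewrite divr_gt0 // mulr_gt0 // ltr_wpDl.
have [Y Y0 hY] := exp_level edgeH c20 eta0.
have hY1 : expR (- (Y ^+ m / c)) <= eta.
  apply: le_trans hY; rewrite ler_expR lerN2 ler_wpM2l ?exprn_ge0 // lef_pV2 ?posrE //.
  by rewrite ler_peMl ?(ltW c0) // ler1n.
have k3Y : 0 <= kappa 3 * Y by rewrite mulr_ge0 // ltW.
have B20 : 0 <= kappa 3 * (Y + A) by rewrite mulr_ge0 ?addr_ge0 // ltW.
(* The order of choices matters: [eta] fixes the level [Y], and only then is the accuracy [eps] of
   the limit law chosen, since its cost is proportional to [Y + A]. *)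
pose eps := del / (4 * (kappa 3 * (Y + A) + 1)).
have eps0 : 0 < eps by rewrite divr_gt0 // mulr_gt0 // ltr_wpDl.
have [s0 hs0] := avoid_asymp X_ge0 F_cont F_slope balancedH edgeH eps0.
exists (2 * maxn 1 (maxn s0 s1))%N => d Omega P n w iid nbig h mh h0 hle hge.
have [U1 [U2 [S1 S2 dU k1 k2]]] := exists_halves [set: 'I_n]%SET.
rewrite cardsT card_ord in k1 k2; set k := n./2 in k1 k2.
have : (maxn 1 (maxn s0 s1) <= k)%N by rewrite /k geq_half_double -mul2n.
rewrite !geq_max => /and3P[kp ks0 ks1].
have kn : (k <= n)%N by rewrite /k leq_half_double -addnn leqW // leq_addr.
have np : (0 < n)%N := leq_trans kp kn.
have n3k : (n <= 3 * k)%N by exact: halves_size.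
have kk0 : 0 < kappa k := kappa_gt0 H kp.
have kn0 : 0 < kappa n := kappa_gt0 H np.
have kle : kappa n <= kappa 3 * kappa k := kappa3 H n3k.
set Tn := fun x => pr P (avoid H w [set: 'I_n]%SET x) in hle hge.
pose y := Y / kappa k.
have y0 : 0 <= y by rewrite divr_ge0 // ltW.
have nearT x : 0 <= x -> `|Tn x - limit_profile c n x| <= eps.
  move=> x0; have := hs0 _ _ _ _ _ [set: 'I_n]%SET iid _ x x0.
  by rewrite cardsT card_ord => -> //; exact: leq_trans ks0 kn.
have T1y : pr P (avoid H w U1 y) <= expR (- (Y ^+ m / c)) + eps.
  have := hs0 _ _ _ _ _ U1 iid _ y y0; rewrite k1 => /(_ ks0).
  by rewrite level_kappa // ler_norml lerBlDl => /andP[].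
(* [h x] dominates the probability only at levels above [x]; letting these decrease to [x] and using
   continuity of the profile recovers the bound at [x] itself. *)
have hprofile x : 0 <= x -> limit_profile c n x <= h x + eps.
  move=> x0; rewrite -lerBlDr.
  have cvg : limit_profile c n z - eps @[z --> x^'+] --> limit_profile c n x - eps.
    apply: cvgB; last exact: cvg_cst.
    by apply: cvg_at_right_filter; exact: limit_profile_continuous.
  apply: (cvgr_to_le cvg).
  near=> z; have xz : x < z by near: z; exact: nbhs_right_gt.
  apply: le_trans (hge _ _ x0 xz).
  have := nearT z (ltW (le_lt_trans x0 xz)); rewrite ler_norml => /andP[q _].
  by move: q; rewrite lerBrDr addrC.
have mT : measurable_fun setT Tn by exact: measurable_avoid.
(* Upper estimate: the limit law up to [y], and beyond [y] the product over halves with the integral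
   over [U2] already known to be at most [A / kappa k]. *)
have up := @integral_split_le R h (limit_profile c n) (fun x => pr P (avoid H w U2 x)) eps y
  (pr P (avoid H w U1 y)) mh (limit_profile_measurable _ _) (measurable_avoid _ _ _) h0
  (limit_profile_ge0 _ _) (fun x => pr_ge0 _ _) (ltW eps0) y0 (pr_ge0 _ _).
have {}up := up _.
pose E2 := expR (- (Y ^+ m / (2 * c))).
(* Lower estimate, with the roles of [h] and the profile exchanged: the tail of the profile beyond
   [y] is at most [E2] times an integrable profile. *)
have low := @integral_split_le R (limit_profile c n) h (limit_profile (2 * c) n) eps y
  E2 (limit_profile_measurable _ _) mh (limit_profile_measurable _ _) 
  (limit_profile_ge0 _ _) h0 (limit_profile_ge0 _ _) (ltW eps0) y0 (expR_ge0 _).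
rewrite !integral_limit_profile // in up low.
have {}up : (\int[lebesgue_measure]_(x in `[0%R, +oo[) (h x)%:E <= (g / kappa n + eps * y + pr P (avoid H w U1 y) * (A / kappa k))%:E)%E.
  apply: (le_trans (up _)).
    move=> x x0; have [xy|yx] := leP x y.
      rewrite mulr1; apply: (le_trans (hle x x0)); apply: ler_wpDr; first by rewrite mulr_ge0 ?pr_ge0.
      by have := nearT x x0; rewrite ler_norml lerBlDl => /andP[].
    rewrite mulr0 addr0; apply: (le_trans (hle x x0)); apply: ler_wpDl; first exact: limit_profile_ge0.
    apply: (le_trans (avoid_halves H iid x S1 S2 dU)).
    by rewrite ler_wpM2r ?pr_ge0 // le_avoid // ltW.
  rewrite !EFinD [X in (_ <= _ + X)%E]EFinM leeD2l //; apply: lee_pmul => //.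
  - by rewrite lee_fin pr_ge0.
  - by apply: integral_ge0 => x _; rewrite lee_fin pr_ge0.
  - by have := hA _ _ _ _ _ U2 iid; rewrite k2 => /(_ ks1).
have fin : (\int[lebesgue_measure]_(x in `[0%R, +oo[) (h x)%:E \is a fin_num)%E.
  rewrite ge0_fin_numE; first exact: (le_lt_trans up (ltry _)).
  by apply: integral_ge0 => x _; rewrite lee_fin.
exists (fine (\int[lebesgue_measure]_(x in `[0%R, +oo[) (h x)%:E)%E); first by rewrite fineK.
set J := fine _.
have JE : (\int[lebesgue_measure]_(x in `[0%R, +oo[) (h x)%:E)%E = J%:E by rewrite /J fineK.
rewrite JE lee_fin in up; rewrite JE in low.
have {}low : g / kappa n <= J + eps * y + E2 * (g2 / kappa n).
  rewrite -lee_fin !EFinD [X in (_ <= _ + X)%E]EFinM; apply: low => x x0.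
  have [xy|yx] := leP x y.
    rewrite mulr1; apply: (le_trans (hprofile x x0)).
    by apply: ler_wpDr => //; rewrite mulr_ge0 ?expR_ge0.
  rewrite mulr0 addr0 (le_trans _ (ler_wpDl (h0 x) (lexx _))) //.
  rewrite limit_profile_double ler_wpM2r ?expR_ge0 //.
  apply: (le_trans (limit_profile_ler n c20 y0 (ltW yx))).
  (* The size is lowered from [n] to [k] because [y] is scaled by [kappa k], which makes the value
     exactly [E2]. *)
  apply: (le_trans (limit_profile_le c20 kn y0)).
  by rewrite /limit_profile /E2 level_kappa.
have r1 := scaled_upper kn0 kk0 kle Y0 A0 (ltW eps0) (expR_ge0 _) T1y up.
have r2 := scaled_lower kn0 kk0 kle Y0 (ltW eps0) low.
have epsle : kappa 3 * (Y + A) * eps <= del / 4 by exact: mul_small.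
have etale : (kappa 3 * A + g2) * eta <= del / 4 by exact: mul_small.
apply: (final_bound epsle _ _ _ del0 r1 r2).
- apply: le_trans etale; apply: ler_pM; rewrite ?expR_ge0 //.
  by rewrite lerDl ltW.
- apply: le_trans epsle; rewrite ler_wpM2r ?(ltW eps0) // ler_wpM2l ?(ltW k30) //.
  by rewrite lerDl.
- apply: le_trans etale; apply: ler_pM; rewrite ?expR_ge0 ?(ltW g20) //.
  by rewrite lerDr.
Unshelve. all: by end_near. Qed.

End ScaledLimit.

Lemma copies_exist (T : finType) (H : graph T) n :
  (0 < nedges H)%N -> (nverts H <= n)%N -> exists G : graph 'I_n, G \in copies H n.
Proof.
move=> edgeH vn; have n0 : (0 < n)%N := leq_trans (v_gt0 edgeH) vn.
have [G] : exists G, G \in copies_in H [set: 'I_n]%SET.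
  apply/card_gt0P; have := card_copies_in H [set: 'I_n]%SET n0.
  rewrite cardsT card_ord; case: #|copies_in H _| => // /esym/eqP.
  by rewrite mul0n -leqn0 leqNgt ffact_gt0 vn.
by rewrite mem_copies_in => /andP[Gc _]; exists G.
Qed.

Lemma min_weight_ge (R : realType) (T : finType) (H : graph T) n (w : {set 'I_n} -> R) x :
  (0 < nedges H)%N -> (nverts H <= n)%N ->
  (x <= min_weight H w) <-> (forall G, G \in copies H n -> x <= weight w G).
Proof.
move=> edgeH vn; have [G0 G0c] := copies_exist edgeH vn.
split => [h G Gc|h].
  apply: (le_trans h); apply: inf_lbound; last by exists G.
  (* Weights may be negative here, so 0 need not be a lower bound; minus the sum of all absolute
     values is one. *)
  exists (- \sum_(G in copies H n) `|weight w G|) => _ [G' /= G'c <-].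
  rewrite lerNl; apply: (@le_trans _ _ `|weight w G'|).
    by rewrite -normrN ler_norm.
  by rewrite (big_setD1 G') //= lerDl sumr_ge0.
apply: lb_le_inf; first by exists (weight w G0); exists G0.
by move=> _ [G /= Gc <-]; exact: h.
Qed.

(** * The minimum weight as a random variable and its tail formula *)

Section MinWeight.
Context {R : realType} {d0 : measure_display} {Omega0 : measurableType d0}.
Context {P0 : probability Omega0 R} (X : {RV P0 >-> R}).
Hypothesis X_ge0 : forall t, 0 <= X t.
Hypothesis F_cont : continuous (dist_fun X).
Context {T : finType} (H : graph T).
Hypothesis edgeH : (0 < nedges H)%N.
Context {d : measure_display} {Omega : measurableType d} {P : probability Omega R}.
Context {n : nat} (w : {set 'I_n} -> {RV P >-> R}).
Hypothesis w_iid : iid_copies_in X (edges (complete_graph n)) w.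
Hypothesis vn : (nverts H <= n)%N.

Let W t : R := min_weight H (fun e => w e t).

Lemma min_weight_avoid x : [set t | x <= W t] = avoid H w [set: 'I_n]%SET x.
Proof.
apply/seteqP; split => t /=.
  move=> /(min_weight_ge _ _ edgeH vn) h G; rewrite mem_copies_in => /andP[Gc _]; exact: h.
move=> h; apply/(min_weight_ge _ _ edgeH vn) => G Gc; apply: h.
by rewrite mem_copies_in Gc finset.subsetT.
Qed.

Lemma min_weight_measurable : measurable_fun setT W.
Proof.
apply: (measurability (@RGenCInfty.G R)) => [|/= _ [_] [r] -> <-].
  exact: RGenCInfty.measurableE.
rewrite setTI (_ : _ @^-1` _ = [set t | r <= W t]).
  by rewrite min_weight_avoid; exact: avoid_measurable.
by apply/seteqP; split => t; rewrite /= in_itv /= andbT.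
Qed.

Lemma min_weight_ge0_ae : P [set t | W t < 0] = 0%E.
Proof.
have mA : measurable [set t | 0 <= W t].
  by rewrite min_weight_avoid; exact: avoid_measurable.
have E : [set t | W t < 0] = ~` [set t | 0 <= W t].
  by apply/seteqP; split => t /=; rewrite ltNge => /negP.
have mC : measurable [set t | W t < 0] by rewrite E; exact: measurableC.
pose Z := \big[setU/set0]_(e in edges (complete_graph n)) (w e @^-1` `]-oo, 0]).
have mZ : measurable Z by apply: bigsetU_measurable => e _; exact: measurable_preimage_rv.
have sub : [set t | W t < 0] `<=` Z.
  move=> t; rewrite E /= => nW; apply: contrapT => nZ; apply: nW.
  apply/(min_weight_ge _ _ edgeH vn) => G Gc; apply: sumr_ge0 => e eG.
  rewrite leNgt; apply/negP => we; apply: nZ.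
  rewrite /Z -bigcup_seq_cond; exists e; last by rewrite /= in_itv /= ltW.
  by rewrite /= mem_index_enum (fintype.subsetP (copy_edges_sub G)).
rewrite (prE P mC); congr EFin; apply/eqP; rewrite eq_le pr_ge0 andbT.
apply: (le_trans (le_pr _ mC mZ sub)).
apply: le_trans (pr_bigcup_le _ _ _ _) _; first by move=> e; exact: measurable_preimage_rv.
by rewrite big1 // => e eE; rewrite (iid_pr_le0 X_ge0 F_cont w_iid).
Qed.

(** The expectation is the integral of the tail [Pr (W > x)], whereas avoidance is the event
    [W >= x]; the two agree only up to an arbitrarily small change of level, hence the pair of
    inequalities on [h]. *)
Lemma expectation_min_weight : exists h : R -> R,
  [/\ measurable_fun setT h, forall x, 0 <= h x,
      forall x, 0 <= x -> h x <= pr P (avoid H w [set: 'I_n]%SET x),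
      forall x y, 0 <= x -> x < y -> pr P (avoid H w [set: 'I_n]%SET y) <= h x &
      ('E_P[W] = \int[lebesgue_measure]_(x in `[0%R, +oo[) (h x)%:E)%E].
Proof.
(* The tail formula asks for a variable that is non-negative everywhere. [W] is so almost surely,
   and truncation changes it only on a null event. *)
pose W' t := Num.max (W t) 0.
have mW' : measurable_fun setT W'.
  exact: measurable_maxr min_weight_measurable (measurable_cst _).
pose Y : {RV P >-> R} := HB.pack_for {mfun Omega >-> R} W' (isMeasurableFun.Build _ _ _ _ _ mW').
have Y0 t : 0 <= Y t by rewrite /Y /= /W' le_max lexx orbT.
have mY B : measurable B -> measurable (Y @^-1` B) by exact: (measurable_preimage_rv (fun=> Y) tt).
pose h x := pr P (Y @^-1` `]x, +oo[).
have Ygt x t : 0 <= x -> (Y @^-1` `]x, +oo[) t <-> x < W t.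
  by move=> x0; rewrite /Y /= /W' in_itv /= andbT lt_max [x < 0]ltNge x0 orbF.
exists h; split.
- apply: nonincreasing_measurable => // x y xy; apply: le_pr; try exact: mY.
  by move=> t /=; rewrite !in_itv /= !andbT; exact: le_lt_trans.
- by move=> x; exact: pr_ge0.
- move=> x x0; rewrite -min_weight_avoid; apply: le_pr; [exact: mY| |].
    by rewrite min_weight_avoid; exact: avoid_measurable.
  by move=> t /(Ygt _ _ x0)/ltW.
- move=> x y x0 xy; rewrite -min_weight_avoid; apply: le_pr; [|exact: mY|].
    by rewrite min_weight_avoid; exact: avoid_measurable.
  by move=> t /= yW; apply/(Ygt _ _ x0); exact: lt_le_trans yW.
transitivity ('E_P[Y])%E; last first.
  rewrite ge0_expectation_ccdf //; apply: eq_integral => x _.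
  by rewrite /h -prE //; exact: mY.
rewrite unlock; apply: ae_eq_integral => //.
- by apply/measurable_EFinP; exact: min_weight_measurable.
- by apply/measurable_EFinP.
exists [set t | W t < 0]; split.
- rewrite (_ : [set t | _] = ~` [set t | 0 <= W t]).
    by apply: measurableC; rewrite min_weight_avoid; exact: avoid_measurable.
  by apply/seteqP; split => t /=; rewrite ltNge => /negP.
- exact: min_weight_ge0_ae.
- move=> t /= ne; rewrite ltNge; apply/negP => W0; apply: ne => _.
  by rewrite /Y /= /W' max_l.
Qed.

End MinWeight.

Theorem theorem6 (R : realType)
    (T : finType) (H : graph T)
    (balancedH : strictly_balanced H) (edgeH : (0 < nedges H)%N)
    (d0 : measure_display) (Omega0 : measurableType d0)
    (P0 : probability Omega0 R) (X : {RV P0 >-> R})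
    (X_ge0 : forall t : Omega0, 0 <= X t)
    (X_int : P0.-integrable [set: Omega0] (EFin \o X))
    (F_cont : continuous (dist_fun X))
    (F_slope : has_right_derivative (dist_fun X) 0 1)
    (dn : nat -> measure_display) (Omega : forall n, measurableType (dn n))
    (P : forall n, probability (Omega n) R)
    (w : forall n, {set 'I_n} -> {RV (P n) >-> R})
    (w_iid : forall n, iid_copies_in X (edges (complete_graph n)) (w n)) :
  let m : nat := nedges H in
  let a : nat := nauto H in
  let d : R := density R H in
  let W (n : nat) (t : Omega n) : R := min_weight H (fun e => w n e t) in
  (forall z : nat -> R, (forall n, 0 <= z n) ->
    fine (P n [set t | z n / n%:R `^ d^-1 <= W n t])
      - expR (- (z n ^+ m / (m`! * a)%:R)) @[n --> \oo] --> 0)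
  /\
  ('E_(P n)[W n]
    / (n%:R `^ (- d^-1) * ((m`! * a)%:R `^ m%:R^-1 / m%:R)
        * Gamma (m%:R^-1 : R))%R%:E)%E @[n --> \oo] --> 1%E.
Proof.
move=> m a d W.
have kE n : n%:R `^ d^-1 = @kappa R T H n by rewrite /d /density invf_div.
pose c : R := (m`! * a)%:R.
have c0 : 0 < c := c_gt0 H.
have g0 : 0 < limit_mean H c := limit_mean_gt0 edgeH c0.
split.
  move=> z z0; apply/cvgr0Pnorm_le => eps eps0.
  have [s0 hs0] := avoid_asymp X_ge0 F_cont F_slope balancedH edgeH eps0.
  near=> n.
  have vn : (nverts H <= n)%N by near: n; exact: nbhs_infty_ge.
  have sn : (s0 <= n)%N by near: n; exact: nbhs_infty_ge.
  have n0 : (0 < n)%N := leq_trans (v_gt0 edgeH) vn.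
  have x0 : 0 <= z n / kappa H n by rewrite divr_ge0 // ltW // kappa_gt0.
  have := hs0 _ _ _ _ _ [set: 'I_n]%SET (w_iid n) _ _ x0.
  rewrite cardsT card_ord => /(_ sn); rewrite level_kappa // kE.
  by rewrite -min_weight_avoid.
have den n : n%:R `^ (- d^-1) * ((m`! * a)%:R `^ m%:R^-1 / m%:R) * Gamma (m%:R^-1 : R)
    = limit_mean H c / kappa H n.
  by rewrite powRN kE /limit_mean -/m -/c mulrC [_^-1 * _]mulrC mulrA [Gamma _ * _]mulrC.
pose J n : R := fine ('E_(P n)[W n])%E.
(* [J] is the real part of an extended expectation; they are identified for large [n], where
   [scaled_limit] provides finiteness. *)
have finJ : \forall n \near \oo, ('E_(P n)[W n])%E = (J n)%:E.
  have [s2 hs2] := scaled_limit X_ge0 X_int F_cont F_slope balancedH edgeH (@ltr01 R).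
  near=> n.
  have vn : (nverts H <= n)%N by near: n; exact: nbhs_infty_ge.
  have sn : (s2 <= n)%N by near: n; exact: nbhs_infty_ge.
  have [h [mh h0 hle hge EW]] := expectation_min_weight X_ge0 F_cont edgeH (w_iid n) vn.
  have [j jE _] := hs2 _ _ _ _ _ (w_iid n) sn h mh h0 hle hge.
  by rewrite /J /W EW jE.
have limJ : kappa H n * J n @[n --> \oo] --> limit_mean H c.
  apply/cvgrPdist_le => eps eps0.
  have [s2 hs2] := scaled_limit X_ge0 X_int F_cont F_slope balancedH edgeH eps0.
  near=> n.
  have vn : (nverts H <= n)%N by near: n; exact: nbhs_infty_ge.
  have sn : (s2 <= n)%N by near: n; exact: nbhs_infty_ge.
  have [h [mh h0 hle hge EW]] := expectation_min_weight X_ge0 F_cont edgeH (w_iid n) vn.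
  have [j jE hj] := hs2 _ _ _ _ _ (w_iid n) sn h mh h0 hle hge.
  by rewrite distrC /J /W EW jE.
have E : \forall n \near \oo, (kappa H n * J n / limit_mean H c)%:E =
   ('E_(P n)[W n] / (n%:R `^ (- d^-1) * ((m`! * a)%:R `^ m%:R^-1 / m%:R)
        * Gamma (m%:R^-1 : R))%R%:E)%E.
  near=> n.
  have n0 : (0 < n)%N by near: n; exact: nbhs_infty_gt.
  have -> : ('E_(P n)[W n])%E = (J n)%:E by near: n.
  have k0 := @kappa_gt0 R T H n n0.
  (* The denominator is a non-zero real, so the quotient of extended reals is an ordinary one. *)
  rewrite den inver mulf_eq0 invr_eq0 !gt_eqF //= -EFinM invf_div; congr EFin.
  by rewrite mulrA [kappa H n * _]mulrC.
apply: (cvg_trans (near_eq_cvg E)).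
apply: cvg_EFin; first by near=> n.
have -> : 1 = limit_mean H c / limit_mean H c by rewrite divff // gt_eqF.
by apply: cvgM => //; exact: cvg_cst.
Unshelve. all: by end_near. Qed.
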